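(* Let $n\le m$ and let $\overline{X}\in\mathbf{M}^{n\times m}$ be a rank one matrix. Then after a permutation of rows and columns it has the form $$\begin{bmatrix}A&\mathbf{0}_{p,m-q}\\ \mathbf{0}_{n-p,q}&\mathbf{0}_{n-p,m-q}\end{bmatrix}$$ for some rank one matrix $A\in\mathbf{M}^{p\times q}$ with all entries nonzero. Consequently, the set $$\mathcal{K}:=\{X\in\mathbf{M}^{n\times m}:\mathrm{rank}\,X=1\ \text{ and }\ \mathrm{supp}\,X=\mathrm{supp}\,\overline{X}\}$$ is a $(p+q-1)$-dimensional analytic manifold. Furthermore, there is a set of matrices $V\in\mathbf{M}^{n\times m}$ of positive measure such that for each $V$ in this set the problem $$\min\,\{\langle V,X\rangle:\|X\|_1+\|X\|_*\le1\}$$ admits a unique minimizer and this minimizer lies in $\mathcal{K}$.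
   Context: $\mathbf{M}^{n\times m}$ is the space of real $n\times m$ matrices with the trace inner product $\langle A,B\rangle=\mathrm{tr}(A^TB)$ and Lebesgue measure; $\|X\|_1=\sum_{i,j}|X_{i,j}|$ is the entrywise $l_1$-norm, $\|X\|_*$ is the nuclear norm (sum of singular values), and $\mathrm{supp}\,X=\{(i,j):X_{i,j}\ne0\}$. $\mathbf{0}_{k,l}$ is the $k\times l$ zero matrix. *)

(* Defs.v *)
From HB Require Import structures.
From mathcomp Require Export all_boot all_order all_algebra.
From mathcomp Require Export all_classical all_reals all_analysis.
From mathcomp Require Export perm.
From mathcomp Require polyrcf.

Set Implicit Arguments.
Unset Strict Implicit.
Unset Printing Implicit Defensive.

Export Order.TTheory GRing.Theory Num.Theory numFieldNormedType.Exports.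

Local Open Scope classical_set_scope.
Local Open Scope ring_scope.

Section Norms.
Context {R : realType} {n m : nat}.
Implicit Types X Y V : 'M[R]_(n, m).

Definition trace_inner V X : R := \tr (V^T *m X).

Definition l1norm X : R := \sum_i \sum_j `|X i j|.

(* The square roots of the eigenvalues of X *m X^T, repeated according to
   algebraic multiplicity.  The char. polynomial of this symmetric matrix splits
   over R and its roots are nonnegative, so [Num.sqrt] never truncates.  There
   are n of them; when m < n the n - m surplus ones are zero. *)
Definition singular_values X : seq R :=
  let p := char_poly (X *m X^T) in
  flatten [seq nseq (mup a p) (Num.sqrt a) | a <- polyrcf.rootsR p].

Definition nuclear_norm X : R := \sum_(s <- singular_values X) s.

Definition supp X : set ('I_n * 'I_m) := [set ij | X ij.1 ij.2 != 0].

Definition rank_sparsity_ball : set 'M[R]_(n, m) :=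
  [set X | l1norm X + nuclear_norm X <= 1].

Definition minimizers (D : set 'M[R]_(n, m)) V : set 'M[R]_(n, m) :=
  [set X | D X /\ forall Y, D Y -> trace_inner V X <= trace_inner V Y].

End Norms.

Section AnalyticManifold.
Context {R : realType} {n m : nat}.

(* Multi-indices are matrices [a] of natural numbers. *)
Definition power_series_term (c : 'M[nat]_(n, m) -> R) (X0 X : 'M[R]_(n, m))
    (a : 'M[nat]_(n, m)) : \bar R :=
  (c a * \prod_i \prod_j (X i j - X0 i j) ^+ a i j)%:E.

(* The sum of an absolutely summable family is the sum of its positive part
   minus that of its negative part. *)
Definition analytic_at (f : 'M[R]_(n, m) -> R) (X0 : 'M[R]_(n, m)) : Prop :=
  exists c : 'M[nat]_(n, m) -> R,
    \forall X \near X0,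
      summable setT (power_series_term c X0 X) /\
      (f X)%:E = (\esum_(a in setT) (power_series_term c X0 X)^\+ a -
                  \esum_(a in setT) (power_series_term c X0 X)^\- a)%E.

(* M is an embedded real-analytic submanifold of dimension d: locally the zero
   set of an analytic submersion. *)
Definition analytic_manifold (d : nat) (M : set 'M[R]_(n, m)) : Prop :=
  exists2 k : nat, (d + k = n * m)%N &
  forall X, M X ->
    exists (U : set 'M[R]_(n, m)) (F : 'M[R]_(n, m) -> 'rV[R]_k),
      [/\ open U, U X,
          forall Y, U Y -> forall l, analytic_at (fun Z => F Z ord0 l) Y,
          forall Y, U Y -> forall w : 'rV[R]_k, exists v, 'd F Y v = w &
          M `&` U = [set Y | U Y /\ F Y = 0]].

End AnalyticManifold.

Section LebesgueMeasure.
Context {R : realType} {n m : nat}.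

Definition box (a b : 'M[R]_(n, m)) : set 'M[R]_(n, m) :=
  [set X | forall i j, a i j <= X i j <= b i j].

Definition box_volume (a b : 'M[R]_(n, m)) : R :=
  \prod_i \prod_j (b i j - a i j).

Definition box_cover (S : set 'M[R]_(n, m)) (a b : nat -> 'M[R]_(n, m)) :=
  (forall k i j, a k i j <= b k i j) /\ S `<=` \bigcup_k box (a k) (b k).

(* Lebesgue outer measure on the space of matrices; on Borel sets it is the
   Lebesgue measure. *)
Definition lebesgue_mx (S : set 'M[R]_(n, m)) : \bar R :=
  ereal_inf [set v | exists a b : nat -> 'M[R]_(n, m), box_cover S a b /\
    v = (\sum_(0 <= k <oo) (box_volume (a k) (b k))%:E)%E].

Definition borel_mx (S : set 'M[R]_(n, m)) : Prop :=
  <<s (@open 'M[R]_(n, m)) >> S.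

End LebesgueMeasure.

(* Main.v *)
Require Import Defs.
From mathcomp Require Import measurable_realfun ring lra.

(** The block form comes from writing Xbar as a product of a column and a row.
    The manifold is cut out near each of its points by the entries off the
    support and the 2x2 minors through a fixed entry of the support.

    For the exposed points let S = a^T b be the sign pattern of Xbar and
    r = |a||b|.  Take V close to V0 = - (1 + 1/r) S, restrict -V to the support,
    and maximize x(-V)y^T / (x S y^T + |x||y|) over the pairs with x S y^T >= 0.
    If lam is the maximum and (u, v) a maximizing pair of unit vectors, then
    -V = lam (S + N) on the support, where N has norm 1, u and v are its top
    singular vectors and its other singular values are smaller than 1; moreover
    u and v have the signs of a and b because N is close to S / r.  Off the
    support -V / lam is small.  Hence -V / lam is a subgradient of the norm at
    u^T v, and the equality cases in the dualities between the l1 and the sup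
    norm and between the nuclear and the operator norm leave a single
    minimizer, a positive multiple of u^T v. *)

Set Implicit Arguments.
Unset Strict Implicit.
Unset Printing Implicit Defensive.

Local Open Scope classical_set_scope.
Local Open Scope ring_scope.

(** * Euclidean norm of row vectors *)

Section Dot.
Context {R : realType}.

Definition dot n (x y : 'rV[R]_n) : R := (x *m y^T) 0 0.
Definition enorm n (x : 'rV[R]_n) : R := Num.sqrt (dot x x).

Lemma dotE n (x y : 'rV[R]_n) : dot x y = \sum_i x 0 i * y 0 i.
Proof. by rewrite /dot mxE; apply: eq_bigr => i _; rewrite mxE. Qed.

Lemma dotC n (x y : 'rV[R]_n) : dot x y = dot y x.
Proof. by rewrite !dotE; apply: eq_bigr => i _; rewrite mulrC. Qed.

Lemma dotDl n (x y z : 'rV[R]_n) : dot (x + y) z = dot x z + dot y z.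
Proof. by rewrite /dot mulmxDl mxE. Qed.

Lemma dotZl n a (x z : 'rV[R]_n) : dot (a *: x) z = a * dot x z.
Proof. by rewrite /dot -scalemxAl mxE. Qed.

Lemma dotDr n (x y z : 'rV[R]_n) : dot z (x + y) = dot z x + dot z y.
Proof. by rewrite dotC dotDl !(dotC z). Qed.

Lemma dotZr n a (x z : 'rV[R]_n) : dot z (a *: x) = a * dot z x.
Proof. by rewrite dotC dotZl (dotC z). Qed.

Lemma dotNl n (x z : 'rV[R]_n) : dot (- x) z = - dot x z.
Proof. by rewrite -scaleN1r dotZl mulN1r. Qed.

Lemma dotNr n (x z : 'rV[R]_n) : dot z (- x) = - dot z x.
Proof. by rewrite dotC dotNl dotC. Qed.

Lemma dot0l n (z : 'rV[R]_n) : dot 0 z = 0.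
Proof. by rewrite -(scale0r 0) dotZl mul0r. Qed.

Lemma dot_mulmxl n m (x : 'rV[R]_n) (A : 'M[R]_(n, m)) y :
  dot (x *m A) y = dot x (y *m A^T).
Proof. by rewrite /dot trmx_mul trmxK mulmxA. Qed.

Lemma dot_ge0 n (x : 'rV[R]_n) : 0 <= dot x x.
Proof. by rewrite dotE sumr_ge0// => i _; rewrite -expr2 sqr_ge0. Qed.

Lemma dot_eq0 n (x : 'rV[R]_n) : dot x x = 0 -> x = 0.
Proof.
rewrite dotE => /eqP; rewrite psumr_eq0; last first.
  by move=> i _; rewrite -expr2 sqr_ge0.
move=> /allP h; apply/rowP => i; rewrite mxE.
by have := h i (mem_index_enum _); rewrite mulf_eq0 orbb => /eqP.
Qed.

Lemma sqr_enorm n (x : 'rV[R]_n) : enorm x ^+ 2 = dot x x.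
Proof. by rewrite sqr_sqrtr ?dot_ge0. Qed.

Lemma enorm_ge0 n (x : 'rV[R]_n) : 0 <= enorm x.
Proof. exact: sqrtr_ge0. Qed.

Lemma enorm0 n : enorm (0 : 'rV[R]_n) = 0.
Proof. by rewrite /enorm dot0l sqrtr0. Qed.

Lemma enorm_eq0 n (x : 'rV[R]_n) : enorm x = 0 -> x = 0.
Proof. by move=> h; apply: dot_eq0; rewrite -sqr_enorm h expr0n. Qed.

Lemma enormZ n a (x : 'rV[R]_n) : enorm (a *: x) = `|a| * enorm x.
Proof.
by rewrite /enorm dotZl dotZr mulrA -expr2 sqrtrM ?sqr_ge0// sqrtr_sqr.
Qed.

Lemma CauchySchwarz n (x y : 'rV[R]_n) : `|dot x y| <= enorm x * enorm y.
Proof.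
rewrite -ler_sqr ?nnegrE ?mulr_ge0 ?enorm_ge0 ?normr_ge0//.
rewrite exprMn !sqr_enorm real_normK ?num_real//.
have [->|y0] := eqVneq y 0; first by rewrite dotC !dot0l expr0n mulr0.
have yy : 0 < dot y y.
  by rewrite lt_def dot_ge0 andbT; apply: contra_neq y0; exact: dot_eq0.
(* The squared norm of this vector, a multiple of the component of [x] orthogonal to [y], is
   [dot y y] times the Gram determinant of [x] and [y]. *)
have := dot_ge0 (dot y y *: x - dot x y *: y).
rewrite !(dotDl, dotDr, dotNl, dotNr, dotZl, dotZr) (dotC y x).
rewrite [leRHS](_ : _ = dot y y * (dot x x * dot y y - dot x y ^+ 2)); last by ring.
by rewrite pmulr_rge0// subr_ge0.
Qed.

Lemma dot_le n (x y : 'rV[R]_n) : dot x y <= enorm x * enorm y.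
Proof. exact: le_trans (ler_norm _) (CauchySchwarz _ _). Qed.

Lemma enormD n (x y : 'rV[R]_n) : enorm (x + y) <= enorm x + enorm y.
Proof.
rewrite -ler_sqr ?nnegrE ?addr_ge0 ?enorm_ge0//.
rewrite sqr_enorm dotDl !dotDr (dotC y x) sqrrD !sqr_enorm.
have := dot_le x y; lra.
Qed.

Lemma abs_coord_le_enorm n (x : 'rV[R]_n) i : `|x 0 i| <= enorm x.
Proof.
rewrite -ler_sqr ?nnegrE ?enorm_ge0 ?normr_ge0// real_normK ?num_real//.
rewrite sqr_enorm dotE (bigD1 i)//= expr2 lerDl sumr_ge0// => j _.
by rewrite -expr2 sqr_ge0.
Qed.

(** Equality case of Cauchy-Schwarz in the unit ball: the squared norm of [x - y] expands to at most
    1 + 1 - 2 = 0. *)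
Lemma unit_dot_eq n (x y : 'rV[R]_n) :
  dot x x <= 1 -> dot y y <= 1 -> 1 <= dot x y -> x = y.
Proof.
move=> hx hy hxy; apply/eqP; rewrite -subr_eq0; apply/eqP/dot_eq0/eqP.
rewrite eq_le dot_ge0 andbT !(dotDl, dotDr, dotNl, dotNr) (dotC y x); lra.
Qed.

Lemma dot_orthogonal_sum n t (u x : 'rV[R]_n) : dot u x = 0 ->
  dot (t *: u + x) (t *: u + x) = t ^+ 2 * dot u u + dot x x.
Proof.
move=> ux; rewrite !(dotDl, dotDr, dotZl, dotZr) (dotC x u) ux.
by rewrite !mulr0 addr0 add0r mulrA expr2.
Qed.

Lemma enorm_unit n (z : 'rV[R]_n) : dot z z = 1 -> enorm z = 1.
Proof. by move=> z1; rewrite /enorm z1 sqrtr1. Qed.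

Lemma continuous_dot (T : topologicalType) n m (f : T -> 'rV[R]_n)
    (A : 'M[R]_(n, m)) (g : T -> 'rV[R]_m) :
  continuous f -> continuous g -> continuous (fun t => dot (f t *m A) (g t)).
Proof.
move=> cf cg.
have -> : (fun t => dot (f t *m A) (g t)) =
    (fun t => \sum_i (\sum_j f t 0 j * A j i) * g t 0 i).
  by apply/funext => t; rewrite dotE; apply: eq_bigr => i _; rewrite mxE.
have cc k (h : T -> 'rV[R]_k) i : continuous h -> continuous (fun t => h t 0 i).
  move=> ch t.
  exact: (@continuous_comp _ _ _ h (fun M : 'rV[R]_k => M 0 i) t (ch t)
    (@coord_continuous _ _ _ _ _ _)).
apply: continuous_big => [|i _ t]; first exact: add_continuous.
apply: continuousM; last exact: cc.
apply: continuous_big => [|j _ {}t]; first exact: add_continuous.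
by apply: continuousM; [exact: cc|exact: cst_continuous].
Qed.

Lemma compact_unit_sphere n : compact [set x : 'rV[R]_n | dot x x = 1].
Proof.
apply: bounded_closed_compact.
  exists 1; split => // M M1 x /= x1.
  rewrite (le_trans _ (ltW M1))// [leLHS]/Num.norm /= mx_normrE.
  apply/bigmax_leP; split => //= -[i j] _ /=; rewrite ord1.
  by rewrite (le_trans (abs_coord_le_enorm _ _))// /enorm x1 sqrtr1.
have -> : [set x : 'rV[R]_n | dot x x = 1] =
    (fun x : 'rV[R]_n => dot (x *m 1%:M) x) @^-1` [set 1].
  by apply/seteqP; split => x /=; rewrite mulmx1.
apply: closed_comp; last exact: closed_eq.
by move=> x _; apply: continuous_dot => ?; exact: cvg_id.
Qed.

End Dot.

(** * Spectral theorem and singular values *)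

Section Spectral.
Context {R : realType}.

(* The eigenvector maximizes the Rayleigh quotient. *)
Lemma symmetric_eigenvector n (B : 'M[R]_n.+1) : B^T = B ->
  exists (q : 'rV[R]_n.+1) (mu : R), dot q q = 1 /\ q *m B = mu *: q.
Proof.
move=> symB.
have [] := @compact_EVT_max 'rV[R]_n.+1 R (fun x => dot (x *m B) x) _ _
  (@compact_unit_sphere R n.+1).
- exists (delta_mx 0 0) => /=; rewrite dotE (bigD1 ord0)//= big1 ?addr0.
    by rewrite !mxE eqxx mulr1.
  by move=> i i0; rewrite !mxE (negbTE i0) mulr0.
- apply: continuous_subspaceT.
  by apply: continuous_dot => ?; exact: cvg_id.
move=> q; rewrite inE /= => q1 qmax.
pose mu := dot (q *m B) q; exists q, mu; split => //.
have rayleigh x : dot (x *m B) x <= mu * dot x x.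
  have [->|x0] := eqVneq x 0; first by rewrite mul0mx !dot0l mulr0.
  have xx : 0 < dot x x.
    by rewrite lt_def dot_ge0 andbT; apply: contra_neq x0; exact: dot_eq0.
  have e0 : 0 < enorm x by rewrite sqrtr_gt0.
  have := qmax ((enorm x)^-1 *: x); rewrite inE /= dotZl dotZr mulrA -expr2.
  rewrite -sqr_enorm -exprMn mulVf ?gt_eqF// expr1n => /(_ erefl).
  rewrite -scalemxAl dotZl dotZr mulrA -expr2 exprVn sqr_enorm.
  by rewrite mulrC ler_pdivrMr// mulrC (mulrC mu).
apply/eqP; rewrite -subr_eq0; apply/eqP.
have : dot q (q *m B - mu *: q) = 0.
  by rewrite dotDr dotNr dotZr q1 dotC -/mu mulr1 subrr.
have : q *m B = (q *m B - mu *: q) + mu *: q by rewrite subrK.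
move: (_ - _) => w qBE qw.
apply: dot_eq0; apply/eqP; rewrite eq_le dot_ge0 andbT leNgt; apply/negP => ww.
set g := dot w w in ww *.
(* First variation: moving the maximizer [q] by [t] along the residual [w], which is orthogonal to
   [q], changes the quadratic form by 2tg to first order. *)
have key t : 2 * t * g <= t ^+ 2 * (mu * g - dot (w *m B) w).
  have := rayleigh (q + t *: w).
  rewrite mulmxDl -scalemxAl !(dotDl, dotDr, dotZl, dotZr).
  rewrite (dotC w q) qw q1.
  have wBq : dot (w *m B) q = dot (q *m B) w by rewrite dot_mulmxl symB dotC.
  have qBw : dot (q *m B) w = g.
    by rewrite qBE dotDl dotZl qw mulr0 addr0.
  rewrite wBq qBw -/mu -/g; nra.
set h := mu * g - dot (w *m B) w in key.
have hg : 0 <= `|h| by [].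
have hh : h <= `|h| by exact: ler_norm.
(* With this [t] the right side of [key] is at most t^2 |h|, which is less than tg, a
   contradiction. *)
pose t := g / (`|h| + 1).
have t0 : 0 < t by rewrite divr_gt0// ltr_wpDl.
have tg : t * (`|h| + 1) = g by rewrite divfK// gt_eqF// ltr_wpDl.
have := key t; nra.
Qed.

(* Householder reflection exchanging q and the first basis vector. *)
Lemma orthogonal_first_row n (q : 'rV[R]_n.+1) : dot q q = 1 ->
  exists Q : 'M[R]_n.+1, Q *m Q^T = 1%:M /\ row 0 Q = q.
Proof.
move=> q1; pose e : 'rV[R]_n.+1 := delta_mx 0 0.
have e1 : dot e e = 1 by rewrite /dot trmx_delta mul_delta_mx mxE eqxx.
have [->|qe] := eqVneq q e.
  by exists 1%:M; rewrite trmx1 mulmx1 rowE mulmx1.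
pose w := q - e; pose g := dot w w.
have g0 : g != 0.
  by apply: contra_neq qe => /dot_eq0/eqP; rewrite subr_eq0 => /eqP.
have wTw : w *m w^T = g%:M by rewrite [LHS]mx11_scalar.
exists (1%:M - (2 / g) *: (w^T *m w)); split.
  rewrite (_ : (_ - _)^T = 1%:M - (2 / g) *: (w^T *m w)); last first.
    by rewrite linearB linearZ /= trmx_mul trmxK trmx1.
  rewrite mulmxBr mulmx1 mulmxBl mul1mx -!scalemxAl -!scalemxAr.
  rewrite mulmxA -(mulmxA w^T w) wTw mul_mx_scalar -scalemxAl !scalerA.
  rewrite (_ : 2 / g * (2 / g * g) = 2 / g + 2 / g); last by field.
  by rewrite scalerDl opprB addrK subrK.
rewrite rowE mulmxBr mulmx1 -scalemxAr mulmxA -/e.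
have -> : e *m w^T = (dot e w)%:M by rewrite [LHS]mx11_scalar.
(* As [q] and [e] are both unit vectors, g = 2 - 2 [dot e q]; hence the reflection sends [e] to e +
   w = q. *)
have -> : dot e w = - g / 2.
  rewrite /g /w !(dotDl, dotDr, dotNl, dotNr) e1 q1 (dotC e q); lra.
rewrite mul_scalar_mx scalerA (_ : 2 / g * (- g / 2) = -1); last by field.
by rewrite scaleN1r opprK addrC subrK.
Qed.

(** Induction on the size. An orthogonal matrix whose first row is a unit eigenvector clears the
    rest of the first row of the conjugate; symmetry clears the first column, and the remaining
    block is again symmetric. *)
Lemma symmetric_spectral n (B : 'M[R]_n) : B^T = B ->
  exists (Q : 'M[R]_n) (d : 'rV[R]_n),
    Q *m Q^T = 1%:M /\ Q *m B *m Q^T = diag_mx d.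
Proof.
elim: n B => [|n IHn] B.
  by exists 1%:M, 0; split; apply/matrixP => - [].
rewrite -[n.+1]/(1 + n)%N in B * => symB.
have [q [mu [q1 qB]]] := symmetric_eigenvector symB.
have [Q0 [Q0Q0 Q0q]] : exists Q0 : 'M[R]_(1 + n),
    Q0 *m Q0^T = 1%:M /\ row 0 Q0 = q by exact: orthogonal_first_row q1.
pose C : 'M[R]_(1 + n) := Q0 *m B *m Q0^T.
have symC : C^T = C by rewrite /C !trmx_mul trmxK symB mulmxA.
have C0 : row 0 C = mu *: delta_mx 0 0.
  rewrite /C !row_mul Q0q qB -scalemxAl; congr (_ *: _).
  by rewrite -Q0q -row_mul Q0Q0 row1.
have Cur : ursubmx C = 0.
  apply/matrixP => i j; rewrite !mxE !ord1.
  have /rowP/(_ (rshift 1 j)) := C0; rewrite !mxE /=.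
  rewrite (_ : lshift n ord0 = 0); last exact/val_inj.
  by move=> ->; rewrite mulr0.
have Cdl : dlsubmx C = 0.
  by rewrite -[C]symC -trmx_ursub Cur trmx0.
have Cdr : (drsubmx C)^T = drsubmx C by rewrite trmx_drsub symC.
have [Q1 [d [Q1Q1 Q1C]]] := IHn _ Cdr.
pose P : 'M[R]_(1 + n) := block_mx 1%:M 0 0 Q1.
have PT : P^T = block_mx 1%:M 0 0 Q1^T by rewrite tr_block_mx !trmx0 trmx1.
pose Q : 'M[R]_(1 + n) := P *m Q0.
have QT : Q^T = Q0^T *m P^T by rewrite trmx_mul.
suff [QQ QB] : Q *m Q^T = 1%:M /\
    Q *m B *m Q^T = diag_mx (row_mx (ulsubmx C) d).
  by exists Q, (row_mx (ulsubmx C) d).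
rewrite QT !mulmxA -[Q *m Q0^T](mulmxA P) Q0Q0 mulmx1; split.
  rewrite PT /P mulmx_block !(mulmx0, mul0mx, addr0, add0r, mulmx1).
  by rewrite Q1Q1 -scalar_mx_block.
rewrite -[Q *m B](mulmxA P) -[_ *m Q0^T](mulmxA P) -/C PT /P -{1}[C]submxK Cur Cdl.
rewrite !mulmx_block !(mulmx0, mul0mx, addr0, add0r, mulmx1, mul1mx).
rewrite Q1C diag_mx_row; congr block_mx; apply/matrixP => i j.
by rewrite [RHS]mxE !ord1 eqxx.
Qed.

Lemma char_poly_orthogonal_conj n (Q B : 'M[R]_n) : Q *m Q^T = 1%:M ->
  char_poly (Q *m B *m Q^T) = char_poly B.
Proof.
move=> QQ; pose P := map_mx polyC Q.
have PP : P *m map_mx polyC Q^T = 1%:M by rewrite -map_mxM QQ map_mx1.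
rewrite /char_poly /char_poly_mx.
have -> : 'X%:M - map_mx polyC (Q *m B *m Q^T) =
    P *m ('X%:M - map_mx polyC B) *m map_mx polyC Q^T.
  rewrite mulmxBr mulmxBl !map_mxM; congr (_ - _).
  by rewrite mul_mx_scalar -scalemxAl PP scalemx1.
by rewrite !det_mulmx mulrAC -det_mulmx PP det1 mul1r.
Qed.

(** This reads the sum of [singular_values] off a factored characteristic polynomial: a root of [p]
    occurs in [s] as often as its multiplicity, so both sums run over the same multiset. *)
Lemma sum_rootsR (s : seq R) (f : R -> R) (p := \prod_(a <- s) ('X - a%:P)) :
  \sum_(x <- flatten [seq nseq (mup a p) (f a) | a <- polyrcf.rootsR p]) x =
  \sum_(a <- s) f a.
Proof.
have p0 : p != 0.
  by rewrite monic_neq0// monic_prod_XsubC.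
rewrite big_flatten big_map.
rewrite (eq_bigr (fun a => f a *+ count_mem a s)); last first.
  by move=> a _; rewrite big_nseq iter_addr addr0 mu_prod_XsubC.
rewrite -[RHS]big_undup_iterop_count.
rewrite (perm_big (undup s))/=; last first.
  rewrite uniq_perm ?undup_uniq//.
    by apply: (sorted_uniq lt_trans ltxx); exact: polyrcf.sorted_roots.
  move=> x; rewrite -(polyrcf.roots_on_rootsR p0) mem_undup /=.
  by rewrite root_prod_XsubC.
by apply: eq_bigr => a _; rewrite Monoid.iteropE iter_addr addr0.
Qed.

(* The rows of Q diagonalize Y *m Y^T, and row i (Q *m Y) has norm the i-th
   singular value. *)
Lemma nuclear_norm_decomposition n m (Y : 'M[R]_(n, m)) :
  exists Q : 'M[R]_n, [/\ Q *m Q^T = 1%:M,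
    forall i j, i != j -> dot (row i Q *m Y) (row j Q *m Y) = 0 &
    nuclear_norm Y = \sum_i enorm (row i Q *m Y)].
Proof.
have symB : (Y *m Y^T)^T = Y *m Y^T by rewrite trmx_mul trmxK.
have [Q [d [QQ QB]]] := symmetric_spectral symB.
have dotQ i j : dot (row i Q *m Y) (row j Q *m Y) = d 0 i *+ (i == j).
  transitivity ((Q *m (Y *m Y^T) *m Q^T) i j); last by rewrite QB mxE.
  rewrite dotE -!row_mul mulmxA -mulmxA -trmx_mul [RHS]mxE.
  by apply: eq_bigr => k _; rewrite [row i _ _ _]mxE [row j _ _ _]mxE [X in _ = _ * X]mxE.
exists Q; split => //; first by move=> i j /negbTE ij; rewrite dotQ ij.
rewrite /nuclear_norm /singular_values -(char_poly_orthogonal_conj _ QQ) QB.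
rewrite char_poly_trig; last by apply/is_trig_mxP => i j ij; rewrite mxE lt_eqF.
have -> : \prod_(i < n) ('X - (diag_mx d i i)%:P) =
    \prod_(a <- [seq d 0 i | i <- index_enum 'I_n]) ('X - a%:P).
  by rewrite big_map; apply: eq_bigr => i _; rewrite mxE eqxx.
rewrite sum_rootsR big_map; apply: eq_bigr => i _.
by rewrite /enorm dotQ eqxx.
Qed.

End Spectral.

(** * Duality between the nuclear and the operator norm *)

Section NuclearNorm.
Context {R : realType}.

Lemma trace_innerE n m (V X : 'M[R]_(n, m)) :
  trace_inner V X = \sum_i \sum_j V i j * X i j.
Proof.
rewrite exchange_big; apply: eq_bigr => j _ /=.
by rewrite mxE; apply: eq_bigr => i _; rewrite mxE.
Qed.

Lemma trace_innerDl n m (V W X : 'M[R]_(n, m)) :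
  trace_inner (V + W) X = trace_inner V X + trace_inner W X.
Proof. by rewrite /trace_inner linearD mulmxDl linearD. Qed.

Lemma trace_innerZl n m a (V X : 'M[R]_(n, m)) :
  trace_inner (a *: V) X = a * trace_inner V X.
Proof. by rewrite /trace_inner linearZ -scalemxAl linearZ. Qed.

Lemma trace_innerZr n m a (V X : 'M[R]_(n, m)) :
  trace_inner V (a *: X) = a * trace_inner V X.
Proof. by rewrite /trace_inner -scalemxAr linearZ. Qed.

Lemma trace_inner_rank1 n m (V : 'M[R]_(n, m)) x y :
  trace_inner V (x^T *m y) = dot (x *m V) y.
Proof.
rewrite /trace_inner mulmxA mxtrace_mulC mulmxA /dot.
rewrite -trace_mx11 -[RHS]mxtrace_tr trmx_mul trmxK; congr (\tr _).
by rewrite -mulmxA -trmx_mul.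
Qed.

(** An operator norm bound in bilinear form: no supremum is involved and the roles of [E] and its
    transpose are symmetric. *)
Definition op_le n m (c : R) (E : 'M[R]_(n, m)) :=
  forall x y, dot (x *m E) y <= c * (enorm x * enorm y).

Definition contraction n m (N : 'M[R]_(n, m)) := op_le 1 N.

Lemma op_le_enorm n m c (E : 'M[R]_(n, m)) x :
  0 <= c -> op_le c E -> enorm (x *m E) <= c * enorm x.
Proof.
move=> c0 cE; have := cE x (x *m E); rewrite -sqr_enorm expr2 mulrA.
have [->|h] := eqVneq (enorm (x *m E)) 0; first by rewrite mulr_ge0// enorm_ge0.
by rewrite ler_pM2r// lt_def h enorm_ge0.
Qed.

Lemma contraction_enorm n m (N : 'M[R]_(n, m)) x :
  contraction N -> enorm (x *m N) <= enorm x.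
Proof. by move=> /(op_le_enorm x ler01); rewrite mul1r. Qed.

Lemma op_le_tr n m c (N : 'M[R]_(n, m)) : op_le c N -> op_le c N^T.
Proof. by move=> cN x y; rewrite dot_mulmxl trmxK dotC (mulrC (enorm x)). Qed.

Section Orthogonal.
Context {n m : nat} {Q : 'M[R]_n} (QQ : Q *m Q^T = 1%:M).

Lemma orthogonal_rows i j : dot (row i Q) (row j Q) = (i == j)%:R.
Proof.
have -> : (i == j)%:R = (Q *m Q^T) i j by rewrite QQ mxE.
by rewrite dotE [RHS]mxE; apply: eq_bigr => k _; rewrite !mxE.
Qed.

Lemma enorm_row i : enorm (row i Q) = 1.
Proof. by rewrite /enorm orthogonal_rows eqxx sqrtr1. Qed.

Lemma orthogonal_inj (X Y : 'M[R]_(n, m)) :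
  (forall i, row i Q *m X = row i Q *m Y) -> X = Y.
Proof.
move=> h; rewrite -[X]mul1mx -[Y]mul1mx -(mulmx1C QQ) -!mulmxA.
by congr (_ *m _); apply/row_matrixP => i; rewrite !row_mul.
Qed.

Lemma trace_inner_rows (N Y : 'M[R]_(n, m)) :
  trace_inner N Y = \sum_i dot (row i Q *m N) (row i Q *m Y).
Proof.
have -> : trace_inner N Y = trace_inner (Q *m N) (Q *m Y).
  by rewrite /trace_inner trmx_mul mulmxA -(mulmxA _ Q^T) (mulmx1C QQ) mulmx1.
rewrite trace_innerE; apply: eq_bigr => i _; rewrite -!row_mul dotE.
by apply: eq_bigr => j _; rewrite [row i (Q *m N) _ _]mxE [row i (Q *m Y) _ _]mxE.
Qed.

Lemma sum_sqr_dot_row (u : 'rV[R]_n) : \sum_i dot (row i Q) u ^+ 2 = dot u u.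
Proof.
have -> : dot u u = dot (u *m Q^T) (u *m Q^T).
  by rewrite dot_mulmxl trmxK -mulmxA (mulmx1C QQ) mulmx1.
rewrite [RHS]dotE; apply: eq_bigr => i _; rewrite -expr2; congr (_ ^+ 2).
by rewrite dotC dotE mxE; apply: eq_bigr => j _; rewrite !mxE.
Qed.

End Orthogonal.

Lemma row_mul_rank1 n m (x u : 'rV[R]_n) (v : 'rV[R]_m) :
  x *m (u^T *m v) = dot x u *: v.
Proof. by rewrite mulmxA [x *m u^T]mx11_scalar mul_scalar_mx. Qed.

(** Both sides split over the rows of the orthogonal [Q] adapted to [Y]. Cauchy-Schwarz compares the
    summands, since [N] maps each unit row of [Q] to a vector of norm at most 1. *)
Lemma trace_inner_le_nuclear_norm n m (N Y : 'M[R]_(n, m)) :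
  contraction N -> trace_inner N Y <= nuclear_norm Y.
Proof.
move=> cN; have [Q [QQ _ ->]] := nuclear_norm_decomposition Y.
rewrite (trace_inner_rows QQ); apply: ler_sum => i _.
rewrite (le_trans (dot_le _ _))// ler_piMl ?enorm_ge0//.
by rewrite -(enorm_row QQ i) contraction_enorm.
Qed.

(** All images of the rows of [Q] are multiples of [v], so their pairwise orthogonality leaves at
    most one nonzero; by Parseval its coefficient along [u] is 1 or -1. *)
Lemma nuclear_norm_rank1 n m s (u : 'rV[R]_n) (v : 'rV[R]_m) :
  0 <= s -> dot u u = 1 -> dot v v = 1 -> nuclear_norm (s *: (u^T *m v)) = s.
Proof.
move=> s_ge0 u1 v1.
have [Q [QQ orth ->]] := nuclear_norm_decomposition (s *: (u^T *m v)).
have rowE i : row i Q *m (s *: (u^T *m v)) = (s * dot (row i Q) u) *: v.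
  by rewrite -scalemxAr row_mul_rank1 scalerA.
under eq_bigr => i _.
  rewrite rowE enormZ /enorm v1 sqrtr1 mulr1 normrM (ger0_norm s_ge0).
  over.
rewrite -mulr_sumr.
have [->|s0] := eqVneq s 0; first by rewrite mul0r.
have [i ci] : exists i, dot (row i Q) u != 0.
  apply/existsP; rewrite -negb_forall; apply/negP => /forallP h.
  have := sum_sqr_dot_row QQ u; rewrite big1 ?u1; last first.
    by move=> i _; rewrite (eqP (h i)) expr0n.
  by move/eqP; rewrite eq_sym oner_eq0.
have cj j : j != i -> dot (row j Q) u = 0.
  move=> ji; have := orth j i ji; rewrite !rowE dotZl dotZr v1 mulr1.
  by move=> /eqP; rewrite !mulf_eq0 (negbTE s0) (negbTE ci) /= orbF => /eqP.
have := sum_sqr_dot_row QQ u; rewrite (bigD1 i)//= big1 => [|j /cj->]; last first.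
  by rewrite expr0n.
rewrite (bigD1 i)//= big1 => [|j /cj->]; last by rewrite normr0.
rewrite !addr0 u1 => h.
by rewrite -sqrtr_sqr h sqrtr1 mulr1.
Qed.

(** Equality of the sums forces equality row by row. A row of [Q] not killed by [Y] is then not
    shrunk by [N], hence is a multiple of [u]; orthonormality allows only one such row, and equality
    in Cauchy-Schwarz fixes its image. *)
Lemma nuclear_norm_attained n m (N Y : 'M[R]_(n, m)) u v :
  contraction N -> u *m N = v -> dot u u = 1 ->
  (forall x, enorm x <= enorm (x *m N) -> exists t, x = t *: u) ->
  nuclear_norm Y <= trace_inner N Y ->
  exists2 t, 0 <= t & Y = t *: (u^T *m v).
Proof.
move=> cN uN u1 strict.
have [Q [QQ _ ->]] := nuclear_norm_decomposition Y.
rewrite (trace_inner_rows QQ) => le_sum.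
have Nle1 i : enorm (row i Q *m N) <= 1.
  by rewrite -(enorm_row QQ i) contraction_enorm.
have dotle i : dot (row i Q *m N) (row i Q *m Y) <=
    enorm (row i Q *m N) * enorm (row i Q *m Y) by exact: dot_le.
have dotle' i : dot (row i Q *m N) (row i Q *m Y) <= enorm (row i Q *m Y).
  by rewrite (le_trans (dotle i))// ler_piMl ?enorm_ge0.
have dotE' i : enorm (row i Q *m Y) = dot (row i Q *m N) (row i Q *m Y).
  apply/eqP; rewrite -subr_eq0; apply/eqP.
  have : \sum_i (enorm (row i Q *m Y) - dot (row i Q *m N) (row i Q *m Y)) == 0.
    rewrite eq_le sumrB subr_le0 le_sum subr_ge0.
    by apply: ler_sum => j _.
  rewrite psumr_eq0 => [|j _]; last by rewrite subr_ge0.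
  by move=> /allP/(_ i (mem_index_enum _))/eqP.
have [h|] := boolP [forall i, row i Q *m Y == 0].
  exists 0 => //; rewrite scale0r; apply: (orthogonal_inj QQ) => i.
  by rewrite (eqP (forallP h i)) mulmx0.
rewrite negb_forall => /existsP[i Yi].
pose s := enorm (row i Q *m Y).
have s_gt0 : 0 < s.
  by rewrite lt_def enorm_ge0 andbT; apply: contra_neq Yi; exact: enorm_eq0.
have along k : row k Q *m Y != 0 -> exists2 t, row k Q = t *: u & t != 0.
  move=> Yk; have sk : 0 < enorm (row k Q *m Y).
    by rewrite lt_def enorm_ge0 andbT; apply: contra_neq Yk; exact: enorm_eq0.
  have [|t qt] := strict (row k Q).
    rewrite (enorm_row QQ) -(ler_pM2r sk) mul1r {1}dotE'; exact: dotle.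
  exists t => //; apply/eqP => t0; have := enorm_row QQ k.
  by rewrite qt t0 scale0r enorm0 => /esym/eqP; rewrite oner_eq0.
have [t qi t0] := along i Yi.
have tt : t * t = 1.
  have := orthogonal_rows QQ i i.
  by rewrite eqxx qi dotZl dotZr u1 mulr1.
exists s; first exact: ltW.
apply: (orthogonal_inj QQ) => j; rewrite -scalemxAr row_mul_rank1 scalerA.
have [->|ji] := eqVneq j i; last first.
  have dju : dot (row j Q) u = 0.
    have := orthogonal_rows QQ j i; rewrite (negbTE ji) qi dotZr => /eqP.
    by rewrite mulf_eq0 (negbTE t0) => /eqP.
  rewrite dju mulr0 scale0r; apply/eqP; apply: contraT => /along[r qj r0].
  by move: dju; rewrite qj dotZl u1 mulr1 => /eqP; rewrite (negbTE r0).
rewrite {2}qi dotZl u1 mulr1.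
have -> : (s * t) *: v = s *: (row i Q *m N) by rewrite qi -scalemxAl uN scalerA.
have dN : dot (row i Q *m N) (row i Q *m N) <= 1.
  by rewrite -sqr_enorm -(expr1n _ 2) ler_pXn2r ?nnegrE ?enorm_ge0.
rewrite (@unit_dot_eq _ _ (row i Q *m N) (s^-1 *: (row i Q *m Y))) //.
- by rewrite scalerA mulfV ?gt_eqF// scale1r.
- by rewrite dotZl dotZr -sqr_enorm -/s expr2 mulKf ?mulVf ?gt_eqF.
- by rewrite dotZr -dotE' -/s mulVf ?gt_eqF.
Qed.

End NuclearNorm.

(** * Minimizers of rank one *)

Section Optimality.
Context {R : realType} {n m : nat}.
Implicit Types (V G N X Y E M : 'M[R]_(n, m)).

Lemma l1normZ t X : l1norm (t *: X) = `|t| * l1norm X.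
Proof.
rewrite /l1norm mulr_sumr; apply: eq_bigr => i _.
by rewrite mulr_sumr; apply: eq_bigr => j _; rewrite mxE normrM.
Qed.

Lemma l1norm_ge0 X : 0 <= l1norm X.
Proof. by apply: sumr_ge0 => i _; apply: sumr_ge0. Qed.

Lemma trace_inner_le_l1norm G Y :
  (forall i j, `|G i j| <= 1) -> trace_inner G Y <= l1norm Y.
Proof.
move=> G1; rewrite trace_innerE; apply: ler_sum => i _; apply: ler_sum => j _.
by rewrite (le_trans (ler_norm _))// normrM ler_piMl.
Qed.

(* G + N is a subgradient of the objective norm along the ray spanned by
   u^T *m v, and the strictness of the contraction N off the line spanned by u
   makes that ray the whole face exposed by V. *)
Lemma minimizers_rank1 V G N (lam : R) (u : 'rV[R]_n) (v : 'rV[R]_m)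
    (t := (l1norm (u^T *m v) + 1)^-1) :
  0 < lam -> V = - (lam *: (G + N)) ->
  (forall i j, `|G i j| <= 1) ->
  (forall i j, G i j * (u 0 i * v 0 j) = `|u 0 i * v 0 j|) ->
  contraction N -> u *m N = v -> dot u u = 1 -> dot v v = 1 ->
  (forall x, enorm x <= enorm (x *m N) -> exists t, x = t *: u) ->
  minimizers rank_sparsity_ball V = [set t *: (u^T *m v)].
Proof.
move=> lam0 VE G1 Guv cN uN u1 v1 strict.
set X1 := u^T *m v; set X0 := t *: X1.
have uvE i j : X1 i j = u 0 i * v 0 j by rewrite mxE big_ord1 mxE.
have t0 : 0 < t by rewrite invr_gt0 ltr_wpDl// l1norm_ge0.
have inner Y : trace_inner V Y = - (lam * (trace_inner G Y + trace_inner N Y)).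
  by rewrite VE -scaleNr trace_innerZl trace_innerDl mulNr.
have GX1 : trace_inner G X1 = l1norm X1.
  rewrite trace_innerE; apply: eq_bigr => i _; apply: eq_bigr => j _.
  by rewrite uvE Guv.
have NX1 : trace_inner N X1 = 1 by rewrite trace_inner_rank1 uN.
have fX0 : l1norm X0 + nuclear_norm X0 = 1.
  rewrite l1normZ gtr0_norm// nuclear_norm_rank1//; last exact: ltW.
  by rewrite -{2}[t]mulr1 -mulrDr mulVf// gt_eqF// ltr_wpDl// l1norm_ge0.
have VX0 : trace_inner V X0 = - lam.
  rewrite inner !trace_innerZr GX1 NX1 -mulrDr mulVf ?mulr1//.
  by rewrite gt_eqF// ltr_wpDl// l1norm_ge0.
have ballX0 : rank_sparsity_ball X0 by rewrite /rank_sparsity_ball /mkset fX0.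
(* The two dualities bound the pairing with G + N by the norm of [Y], which is at most 1 on the
   ball. *)
have lower Y : rank_sparsity_ball Y -> - lam <= trace_inner V Y.
  move=> /= fY; rewrite inner lerN2 -[leRHS]mulr1 ler_pM2l//.
  apply: le_trans fY; apply: lerD; first exact: trace_inner_le_l1norm.
  exact: trace_inner_le_nuclear_norm.
apply/seteqP; split => [Y [fY minY]|_ ->]; last first.
  by split=> [|Y fY]; [exact: ballX0|rewrite VX0 lower].
have := minY X0 ballX0; rewrite VX0 inner lerN2 -[leLHS]mulr1 ler_pM2l// => le1.
have lG := trace_inner_le_l1norm Y G1.
have lN := trace_inner_le_nuclear_norm Y cN.
have {}fY : l1norm Y + nuclear_norm Y <= 1 by [].
(* A minimizer pairs with G + N to at least 1, so neither duality has any slack. *)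
have NY : nuclear_norm Y <= trace_inner N Y by lra.
have [s s0 YE] := nuclear_norm_attained cN uN u1 strict NY.
have : l1norm Y + nuclear_norm Y = 1 by lra.
rewrite YE l1normZ ger0_norm// nuclear_norm_rank1// -{2}[s]mulr1 -mulrDr => h.
rewrite /= /X0 /t; congr (_ *: _); apply: (mulIf (_ : l1norm X1 + 1 != 0)).
  by rewrite gt_eqF// ltr_wpDl// l1norm_ge0.
by rewrite h mulVf// gt_eqF// ltr_wpDl// l1norm_ge0.
Qed.

Lemma op_le_entrywise (c : R) E :
  (forall i j, `|E i j| <= c) -> op_le (c *+ (n * m)) E.
Proof.
move=> Ec x y; rewrite dotE.
(* The sign of [c] is available only once indices are given: for an empty matrix the hypothesis says
   nothing about [c]. *)
have c0 (i : 'I_n) (j : 'I_m) : 0 <= c by apply: le_trans (Ec i j).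
apply: (@le_trans _ _ (\sum_(j < m) \sum_(i < n) c * (enorm x * enorm y))).
  apply: ler_sum => j _; rewrite mxE mulr_suml; apply: ler_sum => i _.
  rewrite (le_trans (ler_norm _))// !normrM -mulrA mulrCA.
  apply: ler_pM => //.
  by apply: ler_pM => //; exact: abs_coord_le_enorm.
by rewrite !sumr_const !card_ord -mulrnA mulrnAl.
Qed.

End Optimality.

(** * Top singular pair of a perturbed rank one matrix *)

Section Perturbation.
Context {R : realType} {n m : nat}.
Implicit Types (N E M : 'M[R]_(n, m)).

Lemma contraction_unit N :
  (forall x y, dot x x = 1 -> dot y y = 1 -> dot (x *m N) y <= 1) ->
  contraction N.
Proof.
move=> h x y; rewrite mul1r.
have unit k (z : 'rV[R]_k) : enorm z != 0 ->
    dot ((enorm z)^-1 *: z) ((enorm z)^-1 *: z) = 1.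
  by move=> z0; rewrite dotZl dotZr -sqr_enorm expr2 mulKf ?mulVf.
have [/eqP|x0] := eqVneq (enorm x) 0.
  by move=> /eqP/enorm_eq0->; rewrite mul0mx dot0l enorm0 mul0r.
have [/eqP|y0] := eqVneq (enorm y) 0.
  by move=> /eqP/enorm_eq0->; rewrite dotC dot0l enorm0 mulr0.
have := h _ _ (unit _ _ x0) (unit _ _ y0).
rewrite -scalemxAl dotZl dotZr mulrA -invfM ler_pdivrMl ?mulr1//.
by rewrite mulr_gt0// lt_def ?x0 ?y0 enorm_ge0.
Qed.

(* Maximizing the ratio below, instead of solving for the lam with top singular
   value 1, yields lam together with its singular vectors. *)
Lemma max_ratio M (a : 'rV[R]_n) (b : 'rV[R]_m) (r : R) :
  0 <= r -> dot a a = 1 -> dot b b = 1 ->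
  exists u v lam, [/\ dot u u = 1, dot v v = 1, 0 <= dot a u * dot b v,
    dot (u *m M) v = lam * (r * (dot a u * dot b v) + 1) &
    forall x y, dot x x = 1 -> dot y y = 1 -> 0 <= dot a x * dot b y ->
    dot (x *m M) y <= lam * (r * (dot a x * dot b y) + 1)].
Proof.
move=> r0 a1 b1.
pose p (z : 'rV[R]_n * 'rV[R]_m) := dot a z.1 * dot b z.2.
(* The closed condition [0 <= p z] keeps the domain compact and the denominator of [f] at least
   1. *)
pose D := ([set x : 'rV[R]_n | dot x x = 1] `*` [set y : 'rV[R]_m | dot y y = 1])
  `&` [set z | 0 <= p z].
pose f z := dot (z.1 *m M) z.2 / (r * p z + 1).
have cp : continuous p.
  have pE : p = (fun z => dot (a *m 1%:M) z.1 * dot (b *m 1%:M) z.2).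
    by apply/funext => z; rewrite !mulmx1.
  rewrite pE => z; apply: cvgM.
    by apply: continuous_dot => ?; [exact: cst_continuous|exact: cvg_fst].
  by apply: continuous_dot => ?; [exact: cst_continuous|exact: cvg_snd].
have den z : D z -> 0 < r * p z + 1.
  by move=> [_ /= pz]; rewrite ltr_wpDl// mulr_ge0.
have [|||z] := @compact_EVT_max _ R f D.
- by exists (a, b); rewrite /D /p /= a1 b1 mulr1; split.
- apply: compact_closedI.
    by apply: compact_setX; exact: compact_unit_sphere.
  by apply: (@closed_comp _ _ p [set x | 0 <= x]) => //; exact: closed_ge.
- apply: continuous_in_subspaceT => z /set_mem Dz.
  apply: cvgM.
    apply: continuous_dot => ?; [exact: cvg_fst|exact: cvg_snd].
  apply: cvgV; first by rewrite gt_eqF// den.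
  apply: cvgD; last exact: cst_continuous.
  by apply: cvgM; [exact: cst_continuous|exact: cp].
rewrite inE => Dz zmax; have [[/= u1 v1] pz] := Dz.
exists z.1, z.2, (f z); split => //.
  by rewrite /f divfK// gt_eqF// den.
move=> x y x1 y1 xy; have Dxy : D (x, y) by [].
by have := zmax (x, y); rewrite inE => /(_ Dxy); rewrite /f/= ler_pdivrMr ?(den (x, y)).
Qed.

(** Let [y] be the part of [x] orthogonal to [u]. Its image is orthogonal to [v], so [y] is not
    shrunk either. But [y] is nearly orthogonal to [a], which gives |yN| <= s |a.y| + e |y| <= 5e
    |y| <= (5/8) |y|, hence y = 0. *)
Lemma strict_off_top_line N F (a u : 'rV[R]_n) (b v : 'rV[R]_m) (s c : R) f e :
  0 <= s -> s <= 2 -> 1 / 2 <= c -> 0 <= e -> e <= 1 / 8 ->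
  N = s *: (a^T *m b) + F -> op_le e F -> u = c *: a + f -> enorm f <= e ->
  u *m N = v -> v *m N^T = u -> dot u u = 1 -> dot v v = 1 -> dot b b = 1 ->
  forall x, enorm x <= enorm (x *m N) -> exists t, x = t *: u.
Proof.
move=> s0 s2 c2 e0 e8 NE Fe uE fe uN vN u1 v1 b1 x xle.
have [t [y [xE yu]]] : exists t y, x = t *: u + y /\ dot u y = 0.
  exists (dot x u), (x - dot x u *: u); split; first by rewrite addrC subrK.
  by rewrite dotDr dotNr dotZr u1 mulr1 dotC subrr.
exists t; suff y0 : y = 0 by rewrite xE y0 addr0.
have yN : dot v (y *m N) = 0 by rewrite dotC dot_mulmxl vN dotC.
have yle : enorm y <= enorm (y *m N).
  move: xle; rewrite /enorm !ler_sqrt ?dot_ge0// xE.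
  rewrite mulmxDl -scalemxAl uN !dot_orthogonal_sum// u1 v1 mulr1.
  by rewrite lerD2l.
have y_ge0 := enorm_ge0 y.
have ay : `|c * dot a y| <= e * enorm y.
  have -> : c * dot a y = - dot f y.
    by move: yu; rewrite uE dotDl dotZl => /eqP; rewrite addr_eq0 => /eqP.
  by rewrite normrN (le_trans (CauchySchwarz _ _))// ler_wpM2r.
have {}ay : `|dot a y| <= 2 * (e * enorm y).
  have c0 : 0 <= c by lra.
  rewrite normrM (ger0_norm c0) in ay.
  have := ler_wpM2r (normr_ge0 (dot a y)) c2.
  move: ay; clear; lra.
have yNle : enorm (y *m N) <= s * `|dot a y| + e * enorm y.
  rewrite NE mulmxDr -scalemxAr row_mul_rank1 scalerA.
  rewrite (le_trans (enormD _ _))// enormZ (enorm_unit b1) mulr1 normrM (dotC y).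
  by rewrite (ger0_norm s0) lerD2l op_le_enorm.
have k : s * `|dot a y| <= 2 * (2 * (e * enorm y)) by apply: ler_pM.
have k2 : e * enorm y <= 1 / 8 * enorm y by rewrite ler_wpM2r.
apply: enorm_eq0; apply/eqP; rewrite eq_le y_ge0 andbT.
move: yle yNle k k2; clear; lra.
Qed.

(** [lam], [u] and [v] come from [max_ratio], and [N] is solved from the decomposition of [M].
    Maximality bounds [N] by 1 with equality at (u, v), which makes [u] and [v] a singular pair; one
    application of [N] or its transpose then shows them close to the lines of [b] and [a]. *)
Lemma perturbed_top_singular_pair E (a : 'rV[R]_n) (b : 'rV[R]_m) (r eps : R)
    (M := (r + 1) *: (a^T *m b) + E) :
  0 <= r -> 0 <= eps -> 16 * (eps * (r + 1)) <= 1 ->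
  dot a a = 1 -> dot b b = 1 -> op_le eps E ->
  exists (lam : R) N (u : 'rV[R]_n) (v : 'rV[R]_m),
  [/\ 1 / 2 < lam, M = lam *: (r *: (a^T *m b) + N), contraction N,
      u *m N = v /\ v *m N^T = u & [/\ dot u u = 1, dot v v = 1,
      forall x, enorm x <= enorm (x *m N) -> exists t, x = t *: u,
      exists c f, [/\ u = c *: a + f, 1 / 2 <= c & enorm f <= 2 * eps] &
      exists c f, [/\ v = c *: b + f, 1 / 2 <= c & enorm f <= 2 * eps]]].
Proof.
move=> r0 eps0 eps_small a1 b1 Ele.
have [u [v [lam [u1 v1 uv_ge0 Muv Mle]]]] := max_ratio M r0 a1 b1.
have reps0 : 0 <= eps * r by rewrite mulr_ge0.
have small : eps * r + eps <= 1 / 16 by lra.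
have ME x y : dot (x *m M) y = (r + 1) * (dot a x * dot b y) + dot (x *m E) y.
  rewrite mulmxDr dotDl -scalemxAr dotZl row_mul_rank1 dotZl.
  by rewrite (dotC x) (dotC b).
have Eunit x y : dot x x = 1 -> dot y y = 1 -> dot (x *m E) y <= eps.
  by move=> x1 y1; have := Ele x y; rewrite !enorm_unit// !mulr1.
have dot_le1 k (y z : 'rV[R]_k) : dot y y = 1 -> dot z z = 1 -> `|dot y z| <= 1.
  by move=> y1 z1; have := CauchySchwarz y z; rewrite !enorm_unit// mulr1.
have dot_mul_le1 x y : dot x x = 1 -> dot y y = 1 -> dot a x * dot b y <= 1.
  move=> x1 y1; rewrite (le_trans (ler_norm _))// normrM.
  by rewrite -[leRHS]mulr1; apply: ler_pM => //; exact: dot_le1.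
(* Compare with the ratio at (a, b), whose denominator is r + 1. *)
have lam_ge : 1 - eps <= lam.
  have Eab : - eps <= dot (a *m E) b.
    have := Eunit (- a) b; rewrite mulNmx !(dotNl, dotNr) opprK => /(_ a1 b1).
    lra.
  have := Mle a b a1 b1; rewrite ME a1 b1 !mulr1 ler01 => /(_ isT) h.
  nra.
(* At (u, v) the numerator is at most (r + 1) q + eps, and (r + 1) q <= r q + 1 because q <= 1. *)
have lam_le : lam <= 1 + eps.
  have := Eunit u v u1 v1; have := dot_mul_le1 u v u1 v1.
  move: Muv; rewrite ME; move: uv_ge0; set q := dot a u * dot b v.
  move: (dot (u *m E) v) => e q0 h q1 ele.
  have rq : 0 <= r * q by rewrite mulr_ge0.
  nra.
have lam0 : 1 / 2 < lam by lra.
have lamN0 : lam != 0 by rewrite gt_eqF//; lra.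
(* The coefficient of [a^T *m b] left in [N]. The upper bound on [lam] makes it nonnegative, the
   lower bound makes it at most 2. *)
pose s := (r + 1 - lam * r) / lam.
have s_ge0 : 0 <= s by rewrite divr_ge0//; nra.
have s_le2 : s <= 2 by rewrite ler_pdivrMr; nra.
pose N := s *: (a^T *m b) + lam^-1 *: E.
have MN : M = lam *: (r *: (a^T *m b) + N).
  rewrite /N addrA -scalerDl scalerDr !scalerA mulfV// scale1r; congr (_ *: _ + _).
  by rewrite /s; field.
have NE x y : dot (x *m N) y =
    s * (dot a x * dot b y) + lam^-1 * dot (x *m E) y.
  rewrite mulmxDr dotDl -!scalemxAr !dotZl row_mul_rank1 dotZl.
  by rewrite (dotC x) (dotC b).
have NM x y : lam * dot (x *m N) y = dot (x *m M) y - lam * r * (dot a x * dot b y).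
  by rewrite NE ME /s; field.
have lam_gt0 : 0 < lam by lra.
have cN : contraction N.
  apply: contraction_unit => x y x1 y1.
  (* Pairs in the domain of the maximization are covered by maximality; for the others the rank one
     term is nonpositive and only [E] remains. *)
  have [xy|xy] := leP 0 (dot a x * dot b y).
    rewrite -(ler_pM2l lam_gt0) NM mulr1.
    by have := Mle x y x1 y1 xy; lra.
  rewrite -(ler_pM2l lam_gt0) NE mulr1 mulrDr mulVKf//.
  have := Eunit x y x1 y1.
  have : lam * (s * (dot a x * dot b y)) <= 0.
    by rewrite pmulr_rle0// mulr_ge0_le0// ltW.
  lra.
have Nuv : dot (u *m N) v = 1.
  by apply: (mulfI lamN0); rewrite NM Muv; ring.
have uN : u *m N = v.
  apply: unit_dot_eq; rewrite ?v1 ?Nuv// -sqr_enorm expr_le1 ?enorm_ge0//.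
  by rewrite -(enorm_unit u1) contraction_enorm.
have cNT : contraction N^T by exact: op_le_tr.
have vN : v *m N^T = u.
  apply: unit_dot_eq; [|by rewrite u1|by rewrite dot_mulmxl trmxK dotC Nuv].
  rewrite -sqr_enorm expr_le1 ?enorm_ge0//.
  by rewrite -(enorm_unit v1) contraction_enorm.
have eta : lam^-1 * eps <= 2 * eps.
  by rewrite ler_wpM2r// -[leRHS]invrK lef_pV2 ?posrE ?invr_gt0//; lra.
have lamV0 : 0 <= lam^-1 by rewrite invr_ge0 ltW.
have fE k l (F : 'M[R]_(k, l)) (y : 'rV_k) : op_le eps F ->
    enorm (lam^-1 *: (y *m F)) <= 2 * eps * enorm y.
  move=> Fle; rewrite enormZ ger0_norm//.
  rewrite (le_trans (ler_wpM2l lamV0 (op_le_enorm _ eps0 Fle)))// mulrA.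
  by rewrite ler_wpM2r// enorm_ge0.
have ETle : op_le eps E^T by exact: op_le_tr.
(* Flip the sign of the pair so that u and v point in the directions a and b. *)
have [sg [sg1 au bv]] : exists sg : R, [/\ sg * sg = 1,
    0 <= sg * dot a u & 0 <= sg * dot b v].
  have [au|au] := leP 0 (dot a u); have [bv|bv] := leP 0 (dot b v).
  - by exists 1; split; lra.
  - by exists (-1); split; nra.
  - by exists (-1); split; nra.
  - by exists (-1); split; lra.
have {}u1 : dot (sg *: u) (sg *: u) = 1 by rewrite dotZl dotZr mulrA sg1 mul1r.
have {}v1 : dot (sg *: v) (sg *: v) = 1 by rewrite dotZl dotZr mulrA sg1 mul1r.
have {}uN : (sg *: u) *m N = sg *: v by rewrite -scalemxAl uN.
have {}vN : (sg *: v) *m N^T = sg *: u by rewrite -scalemxAl vN.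
rewrite -!dotZr in au bv.
move: (sg *: u) (sg *: v) u1 v1 uN vN au bv => {u v Muv uv_ge0 Nuv sg sg1}.
move=> u v u1 v1 uN vN au bv.
have NTE : N^T = s *: (b^T *m a) + lam^-1 *: E^T.
  by rewrite linearD !linearZ /= trmx_mul trmxK.
have udec : u = (s * dot b v) *: a + lam^-1 *: (v *m E^T).
  by rewrite -vN NTE mulmxDr -!scalemxAr row_mul_rank1 scalerA (dotC v).
have vdec : v = (s * dot a u) *: b + lam^-1 *: (u *m E).
  by rewrite -uN mulmxDr -!scalemxAr row_mul_rank1 scalerA (dotC u).
have uf := fE _ _ _ v ETle; rewrite (enorm_unit v1) mulr1 in uf.
have vf := fE _ _ _ u Ele; rewrite (enorm_unit u1) mulr1 in vf.
(* [u] has norm 1 and its remainder norm at most 2 eps, so the triangle inequality bounds the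
   coefficient of [a] from below. *)
have cu : 1 - 2 * eps <= s * dot b v.
  have := enormD ((s * dot b v) *: a) (lam^-1 *: (v *m E^T)).
  by rewrite -udec (enormZ (s * _)) (enorm_unit u1) (enorm_unit a1) mulr1
    (ger0_norm (mulr_ge0 s_ge0 bv)); lra.
have cv : 1 - 2 * eps <= s * dot a u.
  have := enormD ((s * dot a u) *: b) (lam^-1 *: (u *m E)).
  by rewrite -vdec (enormZ (s * _)) (enorm_unit v1) (enorm_unit b1) mulr1
    (ger0_norm (mulr_ge0 s_ge0 au)); lra.
exists lam, N, u, v; split => //; split => //.
- apply: (@strict_off_top_line N (lam^-1 *: E) a u b v s (s * dot b v)
    (lam^-1 *: (v *m E^T)) (2 * eps)) => //; [lra|lra|lra|].
  move=> x y; rewrite -scalemxAr dotZl.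
  apply: le_trans (ler_wpM2l lamV0 (Ele x y)) _.
  by rewrite (mulrA lam^-1); apply: ler_wpM2r => //; rewrite mulr_ge0 ?enorm_ge0.
- by exists (s * dot b v), (lam^-1 *: (v *m E^T)); split=> //; lra.
- by exists (s * dot a u), (lam^-1 *: (u *m E)); split=> //; lra.
Qed.

End Perturbation.

(** * Lebesgue outer measure of a box *)

Section LebesgueLowerBound.
Context {R : realType}.

(** Integrate the pointwise bound over [c, d] and exchange sum and integral, all terms being
    nonnegative; an indicator integrates to at most the length of its interval. *)
Lemma series_itv_lower_bound (C a b : nat -> R) (K c d : R) :
  c <= d -> 0 <= K -> (forall k, 0 <= C k) -> (forall k, a k <= b k) ->
  (forall t, c <= t <= d ->
    (K%:E <= \sum_(0 <= k <oo) (C k * (a k <= t <= b k)%R%:R)%:E)%E) ->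
  ((K * (d - c))%:E <= \sum_(0 <= k <oo) (C k * (b k - a k))%:E)%E.
Proof.
move=> cd K0 C0 ab cover.
have mD : measurable `[c, d]%classic by exact: measurable_itv.
pose mu := @lebesgue_measure R.
have muitv x y : x <= y -> mu `[x, y]%classic = (y - x)%:E.
  rewrite /mu lebesgue_measure_itv /= lte_fin le_eqVlt.
  by case: ltgtP => // -> _; rewrite subrr.
pose f k t : \bar R := ((C k)%:E * (\1_`[a k, b k]%classic t)%:E)%E.
have fE k t : f k t = (C k * (a k <= t <= b k)%R%:R)%:E.
  by rewrite /f -EFinM indicE mem_setE in_itv.
have f0 k t : (0 <= f k t)%E by rewrite fE lee_fin mulr_ge0.
have mf k : measurable_fun `[c, d]%classic (f k).
  apply: measurable_funeM; apply/measurable_EFinP.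
  by apply: measurable_indic; exact: measurable_itv.
have intf k : (\int[mu]_(t in `[c, d]) f k t <= (C k * (b k - a k))%:E)%E.
  rewrite ge0_integralZl_EFin//; last first.
    apply/measurable_EFinP; apply: measurable_indic; exact: measurable_itv.
  rewrite EFinM lee_wpmul2l ?lee_fin// -muitv//.
  rewrite integral_indic; [|exact: mD|exact: measurable_itv].
  apply: le_measure; rewrite ?inE; [|exact: measurable_itv|by move=> ? []].
  by apply: measurableI => //; exact: measurable_itv.
apply: (@le_trans _ _ (\sum_(0 <= k <oo) \int[mu]_(t in `[c, d]) f k t)%E); last first.
  apply: lee_nneseries => [k _ _|k _]; last exact: intf.
  by apply: integral_ge0 => t _; exact: f0.
rewrite -integral_nneseries// EFinM -muitv// -integral_cst//.
apply: ge0_le_integral => //.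
- apply: ge0_emeasurable_sum => [k t _ _|k _]; [exact: f0|exact: mf].
- move=> t; rewrite /= in_itv/= => /cover h; apply: (le_trans h).
  apply: lee_nneseries => [k _ _|k _]; last by rewrite fE.
  by rewrite lee_fin mulr_ge0.
Qed.

(* Integrating the indicators of a countable box cover of a cube one coordinate
   at a time (the coordinates in s are integrated out). *)
Lemma box_cover_lower_bound (I : finType) (A B : nat -> I -> R) (c : I -> R)
    (e : R) : 0 <= e -> (forall k i, A k i <= B k i) ->
  (forall x : I -> R, (forall i, c i <= x i <= c i + e) ->
    exists k, forall i, A k i <= x i <= B k i) ->
  ((e ^+ #|I|)%:E <= \sum_(0 <= k <oo) (\prod_i (B k i - A k i))%:E)%E.
Proof.
move=> e0 AB cover.
pose g (s : seq I) (x : I -> R) k i :=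
  if i \in s then B k i - A k i else (A k i <= x i <= B k i)%R%:R.
have g0 s x k i : 0 <= g s x k i.
  by rewrite /g; case: ifP; rewrite ?subr_ge0.
suff key s : uniq s -> forall x : I -> R, (forall i, c i <= x i <= c i + e) ->
    ((e ^+ size s)%:E <= \sum_(0 <= k <oo) (\prod_i g s x k i)%:E)%E.
  have := key (enum I) (enum_uniq I) c; rewrite -cardE => /(_ _)/le_trans.
  apply=> [i|]; first by rewrite lexx lerDl.
  rewrite le_eqVlt; apply/orP; left; apply/eqP; apply: eq_eseriesr => k _.
  by congr EFin; apply: eq_bigr => i _; rewrite /g mem_enum.
elim: s => [|j s IHs] /=.
  (* With no coordinate integrated out, one box containing [x] already contributes 1 to the sum. *)
  move=> _ x xc; have [k Ak] := cover x xc.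
  rewrite expr0 (le_trans _ (@nneseries_lim_ge _ _ xpredT _ k.+1 _))//.
    rewrite big_nat_recr//= -[leLHS]add0e leeD//.
      by apply: sume_ge0 => l _; rewrite lee_fin prodr_ge0.
    by rewrite lee_fin big1// => i _; rewrite /g Ak.
  by move=> l _; rewrite lee_fin prodr_ge0.
move=> /andP[js us] x xc; rewrite exprSr -{2}(addKr (c j) e) addrC.
pose C k := \prod_(i | i != j) g s x k i.
have gj k : \prod_i g (j :: s) x k i = C k * (B k j - A k j).
  rewrite (bigD1 j)//= mulrC; congr (_ * _); last by rewrite /g mem_head.
  by apply: eq_bigr => i ij; rewrite /g in_cons (negbTE ij).
under eq_eseriesr do rewrite gj.
rewrite -[X in _ * X]/(_ - c j); apply: series_itv_lower_bound => //.
- by rewrite lerDl.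
- by rewrite exprn_ge0.
- by move=> k; exact: prodr_ge0.
(* The induction hypothesis at [x] with coordinate [j] moved to [t]; the factor [C k] does not see
   this coordinate. *)
move=> t tc; pose y i := if i == j then t else x i.
have := IHs us y; under eq_eseriesr => k _.
  rewrite (_ : \prod_i g s y k i = C k * (A k j <= t <= B k j)%R%:R); last first.
    rewrite (bigD1 j)//= mulrC; congr (_ * _); last first.
      by rewrite /g (negbTE js) /y eqxx.
    by apply: eq_bigr => i ij; rewrite /g /y (negbTE ij).
  over.
by apply=> i; rewrite /y; case: eqP => [->|].
Qed.

Lemma lebesgue_mx_gt0 n m (S : set 'M[R]_(n, m)) (c : 'M[R]_(n, m)) (e : R) :
  0 < e -> (forall X : 'M[R]_(n, m), (forall i j, c i j <= X i j <= c i j + e) -> S X) ->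
  (0 < lebesgue_mx S)%E.
Proof.
move=> e0 cS.
apply: (@lt_le_trans _ _ (e ^+ #|{: 'I_n * 'I_m}|)%:E).
  by rewrite lte_fin exprn_gt0.
apply: le_ereal_inf_tmp => _ [a [b [[ab Scover] ->]]].
under eq_eseriesr do rewrite /box_volume pair_bigA /=.
pose A k (p : 'I_n * 'I_m) := a k p.1 p.2.
pose B k (p : 'I_n * 'I_m) := b k p.1 p.2.
apply: (@box_cover_lower_bound _ A B (fun p => c p.1 p.2)).
- exact: ltW.
- by move=> k p; exact: ab.
move=> x xc; have [|k _ /= abk] := Scover (\matrix_(i, j) x (i, j)).
  by apply: cS => i j; rewrite mxE; exact: (xc (i, j)).
by exists k => -[i j]; have := abk i j; rewrite mxE.
Qed.

End LebesgueLowerBound.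

(** * Rank one matrices of given support as an analytic manifold *)

Section Polynomial.
Context {R : realType} {n m : nat}.
Implicit Types (X Y : 'M[R]_(n, m)) (f g : 'M[R]_(n, m) -> R).

Definition monomial X0 X (a : 'M[nat]_(n, m)) : R :=
  \prod_i \prod_j (X i j - X0 i j) ^+ a i j.

(** Exponents may repeat in the list, so that sums are concatenations and products are lists of all
    pairs. *)
Definition polynomial_at X0 f := exists l : seq (R * 'M[nat]_(n, m)),
  forall X, f X = \sum_(t <- l) t.1 * monomial X0 X t.2.

Lemma polynomial_cst X0 c : polynomial_at X0 (fun=> c).
Proof.
exists [:: (c, const_mx 0%N)] => X; rewrite big_seq1 /monomial /=.
rewrite big1 ?mulr1// => i _; rewrite big1// => j _; by rewrite mxE expr0.
Qed.

Lemma polynomial_coord X0 i j : polynomial_at X0 (fun X => X i j).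
Proof.
have [l lE] := polynomial_cst X0 (X0 i j).
exists (rcons l (1, \matrix_(i', j') ((i' == i) && (j' == j) : nat))) => X.
rewrite big_rcons/= -lE mul1r /monomial (bigD1 i)//= (bigD1 j)//=.
rewrite mxE !eqxx expr1 !big1 ?mulr1 1?addrC ?subrK// => [i' ii|j' jj].
  by rewrite big1// => j' _; rewrite mxE (negbTE ii) expr0.
by rewrite mxE (negbTE jj) andbF expr0.
Qed.

Lemma polynomialD X0 f g : polynomial_at X0 f -> polynomial_at X0 g ->
  polynomial_at X0 (fun X => f X + g X).
Proof.
by move=> [k kE] [l lE]; exists (k ++ l) => X; rewrite big_cat/= -kE -lE.
Qed.

Lemma polynomialM X0 f g : polynomial_at X0 f -> polynomial_at X0 g ->
  polynomial_at X0 (fun X => f X * g X).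
Proof.
move=> [k kE] [l lE].
exists [seq (s.1 * t.1, \matrix_(i, j) (s.2 i j + t.2 i j)%N) |
  s : R * 'M[nat]_(n, m) <- k, t : R * 'M[nat]_(n, m) <- l].
move=> X; rewrite kE lE big_distrlr /= [RHS]big_allpairs_dep /=.
apply: eq_bigr => s _; apply: eq_bigr => t _; rewrite mulrACA; congr (_ * _).
rewrite /monomial -big_split; apply: eq_bigr => i _ /=.
by rewrite -big_split; apply: eq_bigr => j _ /=; rewrite mxE exprD.
Qed.

Lemma polynomialB X0 f g : polynomial_at X0 f -> polynomial_at X0 g ->
  polynomial_at X0 (fun X => f X - g X).
Proof.
move=> pf pg; apply: polynomialD => //.
have := polynomialM (polynomial_cst X0 (-1)) pg.
by congr polynomial_at; apply/funext => X; rewrite mulN1r.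
Qed.

Lemma esum_finite_support (T : choiceType) (s : seq T) (h : T -> \bar R) :
  uniq s -> (forall a, (0 <= h a)%E) -> (forall a, a \notin s -> h a = 0%E) ->
  (\esum_(a in setT) h a = \sum_(a <- s) h a)%E.
Proof.
move=> us h0 hs.
have -> : (\esum_(a in setT) h a = \esum_(a in [set` s]) h a)%E.
  rewrite [RHS]esum_mkcond; apply: eq_esum => a _.
  by rewrite mem_setE; case: ifPn => // /hs.
by rewrite esum_fset// -fsbig_seq.
Qed.

Lemma polynomial_analytic X0 f : polynomial_at X0 f -> analytic_at f X0.
Proof.
move=> [l lE].
(* Coefficients of equal exponents are collected. Finitely many are nonzero, so the expansion holds
   for every [X], not only near [X0]. *)
exists (fun a => \sum_(t <- l | t.2 == a) t.1); apply: (@filterE _ (nbhs X0)) => X.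
pose s := undup [seq t.2 | t <- l]; have us : uniq s by exact: undup_uniq.
pose v a := (\sum_(t <- l | t.2 == a) t.1) * monomial X0 X a.
have -> : power_series_term (fun a => \sum_(t <- l | t.2 == a) t.1) X0 X =
    fun a => (v a)%:E by [].
have v0 a : a \notin s -> v a = 0.
  rewrite mem_undup => /negP al; rewrite /v big1_seq ?mul0r// => t.
  by move=> /andP[/eqP ta tl]; exfalso; apply: al; rewrite -ta map_f.
have fXE : f X = \sum_(a <- s) v a.
  rewrite lE; under [RHS]eq_bigr do rewrite /v mulr_suml.
  rewrite (exchange_big_dep xpredT)//=; apply: eq_big_seq => t tl.
  rewrite -big_filter (_ : [seq i <- s | t.2 == i] = [:: t.2]) ?big_seq1//.
  rewrite -[RHS](filter_pred1_uniq us); last by rewrite mem_undup map_f.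
  by apply: eq_filter => a /=; rewrite eq_sym.
have max0 a : a \notin s -> Num.max (v a) 0 = 0 /\ Num.max (- v a) 0 = 0.
  by move=> /v0 ->; rewrite oppr0 maxxx.
have posE : (fun a => (v a)%:E)^\+%E = fun a => (Num.max (v a) 0)%:E.
  by apply/funext => a; rewrite funeposE EFin_max.
have negE : (fun a => (v a)%:E)^\-%E = fun a => (Num.max (- v a) 0)%:E.
  by apply/funext => a; rewrite funenegE EFin_max.
have max_ge0 (x : R) : (0 <= (Num.max x 0)%:E)%E by rewrite lee_fin le_max lexx orbT.
split.
  rewrite /summable (esum_finite_support us)//.
    by under eq_bigr do rewrite abse_EFin; rewrite sumEFin ltry.
  by move=> a /v0->; rewrite abse0.
rewrite posE negE !(esum_finite_support us)//; last 2 first.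
- by move=> a /max0[_ ->].
- by move=> a /max0[-> _].
rewrite !sumEFin -EFinB -sumrB fXE; congr EFin; apply: eq_bigr => a _.
by case: (lerP 0 (v a)) => h; case: (lerP 0 (- v a)) => h'; lra.
Qed.

Lemma polynomial_differentiable X0 f Y : polynomial_at X0 f -> differentiable f Y.
Proof.
move=> [l lE].
have -> : f = \sum_(t <- l) (fun X => t.1 * monomial X0 X t.2).
  by apply/funext => X; rewrite lE fct_sumE.
elim/big_ind : _ => [|g h dg dh|t _].
- exact: differentiable_cst.
- exact: differentiableD.
apply: differentiableM; first exact: differentiable_cst.
have -> : (fun X => monomial X0 X t.2) =
    \prod_i \prod_j (fun X : 'M[R]_(n, m) => (X i j - X0 i j) ^+ t.2 i j).
  apply/funext => X; rewrite /monomial fct_prodE; apply: eq_bigr => i _.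
  by rewrite fct_prodE.
elim/big_ind : _ => [|g h dg dh|i _].
- exact: (differentiable_cst (1 : R) Y).
- exact: differentiableM.
elim/big_ind : _ => [|g h dg dh|j _].
- exact: (differentiable_cst (1 : R) Y).
- exact: differentiableM.
case: (t.2 i j) => [|k]; first exact: (differentiable_cst (1 : R) Y).
rewrite (_ : (fun X => _) = (fun X : 'M[R]_(n, m) => X i j - X0 i j) ^+ k.+1);
  last by rewrite exprfctE.
apply: differentiableX; apply: differentiableB; last exact: differentiable_cst.
exact: differentiable_coord.
Qed.

End Polynomial.

Section RankOne.
Context {R : realType} {n m : nat}.

Lemma rank1_factor (X : 'M[R]_(n, m)) : \rank X = 1%N ->
  exists (x : 'rV[R]_n) (y : 'rV[R]_m), [/\ X = x^T *m y, x != 0 & y != 0].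
Proof.
move=> rX; have := mulmx_base X; move: (col_base X) (row_base X).
rewrite rX => c r XE; exists c^T, r; rewrite trmxK; split => //.
- apply/eqP => c0; move: rX; rewrite -XE -[c]trmxK c0 trmx0 mul0mx.
  by rewrite mxrank0.
- by apply/eqP => r0; move: rX; rewrite -XE r0 mulmx0 mxrank0.
Qed.

Lemma mul_col_row (x : 'rV[R]_n) (y : 'rV[R]_m) i j :
  (x^T *m y) i j = x 0 i * y 0 j.
Proof. by rewrite mxE big_ord1 mxE. Qed.

Lemma rank1_mul (x : 'rV[R]_n) (y : 'rV[R]_m) :
  x != 0 -> y != 0 -> \rank (x^T *m y) = 1%N.
Proof.
move=> /rV0Pn[i xi] /rV0Pn[j yj]; apply/eqP; rewrite eqn_leq.
rewrite (leq_trans (mxrankM_maxr _ _)) ?rank_leq_row//= lt0n mxrank_eq0.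
apply: contraNneq (mulf_neq0 xi yj) => /matrixP/(_ i j).
by rewrite mul_col_row mxE => ->.
Qed.

End RankOne.

Section Manifold.
Context {R : realType} {n m : nat}.
Context (P : {set 'I_n}) (Q : {set 'I_m}) (i0 : 'I_n) (j0 : 'I_m)
  (Pi0 : i0 \in P) (Qj0 : j0 \in Q).

Let free_entries : {set 'I_n * 'I_m} :=
  (finset.setX [set i0] Q :|: finset.setX P [set j0])%SET.
Let k := #|(~: free_entries)%SET|.

(** The pivot row and the pivot column of the support share exactly the pivot, whence the [- 1];
    each remaining entry yields one equation. *)
Lemma card_free_entries : (#|P| + #|Q| - 1 + k = n * m)%N.
Proof.
have <- : #|free_entries| = (#|P| + #|Q| - 1)%N.
  rewrite cardsU !cardsX !cards1 mul1n muln1 addnC; congr (_ - _)%N.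
  apply/eqP/cards1P; exists (i0, j0); apply/setP => -[i j].
  rewrite !inE /= xpair_eqE.
  by apply/andP/andP => [[/andP[-> _] /andP[_ ->]]|[/eqP-> /eqP->]]; rewrite ?eqxx ?Pi0 ?Qj0.
by rewrite /k cardsC card_prod !card_ord.
Qed.

(* Off the support the entry itself must vanish, on it the 2x2 minor through
   the pivot (i0, j0); the pivot row and column are free. *)
Definition rank1_equation (ij : 'I_n * 'I_m) (Y : 'M[R]_(n, m)) : R :=
  if (ij.1 \in P) && (ij.2 \in Q)
  then Y ij.1 ij.2 * Y i0 j0 - Y ij.1 j0 * Y i0 ij.2 else Y ij.1 ij.2.

Definition rank1_equations (Y : 'M[R]_(n, m)) : 'rV[R]_k :=
  \row_l rank1_equation (enum_val l) Y.

Lemma rank1_equation_polynomial X0 ij : polynomial_at X0 (rank1_equation ij).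
Proof.
rewrite /rank1_equation; case: (_ && _); last exact: polynomial_coord.
by apply: polynomialB; apply: polynomialM; exact: polynomial_coord.
Qed.

Lemma rank1_equations_differentiable Y : differentiable rank1_equations Y.
Proof.
have -> : rank1_equations = \sum_(l < k) (fun Z : 'M[R]_(n, m) =>
    rank1_equation (enum_val l) Z *: (delta_mx 0 l : 'rV[R]_k)).
  apply/funext => Z; rewrite fct_sumE; apply/rowP => l.
  rewrite summxE (bigD1 l)//= big1 => [|l' ll]; last first.
    by rewrite !mxE eq_sym (negbTE ll) andbF mulr0.
  by rewrite !mxE !eqxx mulr1 addr0.
apply: differentiable_sum => l; apply: differentiableZl.
exact: polynomial_differentiable (rank1_equation_polynomial 0 _).
Qed.

(* Along these directions the equations are affine, so the differential can be
   read off exactly. *)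
Lemma rank1_equations_submersion (Y : 'M[R]_(n, m)) (w : 'rV[R]_k) : Y i0 j0 != 0 ->
  exists v, 'd rank1_equations Y v = w.
Proof.
move=> Y0.
(* [c ij] is the partial derivative of equation [ij] in the entry [ij]. The direction [v] vanishes
   on the free entries, which removes the quadratic term of every minor. *)
pose c (ij : 'I_n * 'I_m) := if (ij.1 \in P) && (ij.2 \in Q) then Y i0 j0 else 1.
have c0 ij : c ij != 0 by rewrite /c; case: ifP; rewrite ?oner_eq0.
pose v : 'M[R]_(n, m) :=
  \matrix_(i, j) \sum_(l < k | enum_val l == (i, j)) w 0 l / c (i, j).
have v_free i j : (i, j) \in free_entries -> v i j = 0.
  move=> ij; rewrite mxE big1// => l /eqP lij.
  by have := enum_valP l; rewrite inE lij ij.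
have v_enum l : v (enum_val l).1 (enum_val l).2 = w 0 l / c (enum_val l).
  rewrite mxE -surjective_pairing (big_pred1 l)// => l' /=.
  by rewrite (inj_eq enum_val_inj).
exists v; rewrite -deriveE; last exact: rank1_equations_differentiable.
have affine (h : R) : rank1_equations (h *: v + Y) = h *: w + rank1_equations Y.
  apply/rowP => l; rewrite 4!mxE /rank1_equation.
  have := v_enum l; have := enum_valP l; rewrite /c.
  case: (enum_val l) => i j /=; rewrite inE => ij.
  have v00 : v i0 j0 = 0 by rewrite v_free// !inE !eqxx Qj0.
  case: ifPn => [/andP[Pi Qj]|_]; rewrite ![(h *: v + Y) _ _]mxE ![(h *: v) _ _]mxE.
    have vi : v i j0 = 0 by rewrite v_free// !inE eqxx Pi orbT.
    have vj : v i0 j = 0 by rewrite v_free// !inE eqxx Qj.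
    rewrite v00 vi vj => ->; rewrite !mulr0 !add0r; field; exact: Y0.
  by move=> ->; rewrite divr1.
rewrite /derive; apply: cvg_lim => //.
apply: (@cvg_trans _ (cst w @ 0^')); last exact: cvg_cst.
apply: near_eq_cvg; near=> h.
have h0 : h != 0 by near: h; exact: nbhs_dnbhs_neq.
by rewrite /= affine addrK scalerA mulVf// scale1r.
Unshelve. all: by end_near. Qed.

Lemma rank1_manifold :
  analytic_manifold (#|P| + #|Q| - 1) [set X : 'M[R]_(n, m) |
    \rank X = 1%N /\ supp X = [set ij | ij.1 \in P /\ ij.2 \in Q]].
Proof.
exists k; first exact: card_free_entries.
move=> X [rX sX].
(* On [U] the support contains P x Q and the pivot is invertible; the equations supply the rest. *)
pose U : set 'M[R]_(n, m) := [set Y | forall i j, i \in P -> j \in Q -> Y i j != 0].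
have oU : open U.
  rewrite openE => Y UY.
  pose f (ij : 'I_n * 'I_m) : set 'M[R]_(n, m) :=
    [set Z | (ij.1 \in P) && (ij.2 \in Q) -> Z ij.1 ij.2 != 0].
  have : nbhs Y [set Z | forall ij, f ij Z].
    apply: (@filter_forall _ _ f (nbhs Y)) => -[i j]; rewrite /f /=.
    have [/andP[Pi Qj]|_] := boolP ((i \in P) && (j \in Q)); last first.
      by apply: filterE.
    have : nbhs (Y i j) [set x | x != 0].
      by apply: open_nbhs_nbhs; split; [exact: open_neq|exact: (UY i j Pi Qj)].
    by move=> /(@coord_continuous R n m i j Y) h; apply: (@filterS _ (nbhs Y)) h => Z ZN _.
  apply: (@filterS _ (nbhs Y)) => Z ZU i j Pi Qj; apply: (ZU (i, j)); by rewrite /= Pi Qj.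
exists U, rank1_equations; split => //.
- move=> i j Pi Qj; have : supp X (i, j) by rewrite sX.
  by [].
- move=> Y _ l; apply: polynomial_analytic.
  have := rank1_equation_polynomial Y (enum_val l).
  by congr polynomial_at; apply/funext => Z; rewrite mxE.
- by move=> Y UY w; apply: rank1_equations_submersion; exact: UY.
apply/seteqP; split => [Y [[rY sY] UY]|Y [UY FY]] /=.
  split=> //; apply/rowP => l; rewrite !mxE /rank1_equation.
  have [x [y [YE _ _]]] := rank1_factor rY.
  case: ifPn => [_|PQ]; first by rewrite YE !mul_col_row; ring.
  apply/eqP; apply: contraNT PQ => YN0.
  have : supp Y (enum_val l) by [].
  by rewrite sY => /= -[-> ->].
have eqn i j : (i, j) \notin free_entries -> rank1_equation (i, j) Y = 0.
  move=> ij; have ij' : (i, j) \in (~: free_entries)%SET by rewrite inE.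
  have /rowP/(_ (enum_rank_in ij' (i, j))) := FY.
  by rewrite !mxE enum_rankK_in.
have YPQ i j : i \in P -> j \in Q -> Y i j = Y i j0 * Y i0 j / Y i0 j0.
  move=> Pi Qj; have Y0 := UY i0 j0 Pi0 Qj0; apply/(canRL (mulfK Y0)).
  have [|/eqn] := boolP ((i, j) \in free_entries).
    by rewrite !inE /= => /orP[/andP[/eqP-> _]|/andP[_ /eqP->]]; rewrite mulrC.
  by rewrite /rank1_equation /= Pi Qj /= => /eqP; rewrite subr_eq0 => /eqP.
have Yoff i j : ~~ ((i \in P) && (j \in Q)) -> Y i j = 0.
  move=> PQ; have : (i, j) \notin free_entries.
    apply: contra PQ; rewrite !inE /= => /orP[/andP[/eqP-> ->]|/andP[-> /eqP->]].
      by rewrite Pi0.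
    by rewrite Qj0.
  by move=> /eqn; rewrite /rank1_equation /= (negbTE PQ).
split; last exact: UY.
split.
  (* The vanishing minors make [Y] the product of its pivot column, divided by the pivot, and its
     pivot row. *)
  pose x : 'rV[R]_n := \row_i (Y i j0 / Y i0 j0); pose y : 'rV[R]_m := row i0 Y.
  have Y0 := UY i0 j0 Pi0 Qj0.
  have -> : Y = x^T *m y.
    apply/matrixP => i j; rewrite mul_col_row !mxE.
    have [/andP[Pi Qj]|PQ] := boolP ((i \in P) && (j \in Q)).
      by rewrite YPQ// mulrAC.
    rewrite Yoff//; move: PQ; rewrite negb_and => /orP[Pi|Qj].
      by rewrite (Yoff i j0) ?mul0r// negb_and Pi.
    by rewrite (Yoff i0 j) ?mulr0// negb_and Qj orbT.
  apply: rank1_mul; apply/rV0Pn.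
    by exists i0; rewrite mxE mulfV ?oner_eq0.
  by exists j0; rewrite mxE.
apply/seteqP; split=> -[i j] /=; last by move=> [Pi Qj]; apply: (UY i j Pi Qj).
by move=> Yij; apply/andP; apply: contraNT Yij => PQ; rewrite Yoff.
Qed.

End Manifold.

(** * Block form after permuting rows and columns *)

Lemma perm_gather n (P : {set 'I_n}) :
  exists s : 'S_n, forall i : 'I_n, (s i \in P) = (i < #|P|)%N.
Proof.
(* The permutation sends a position to the element there in this list, which puts [P] first. *)
pose l := enum P ++ enum (~: P)%SET.
have sl : size l = n by rewrite size_cat -!cardE cardsC card_ord.
have ul : uniq l.
  rewrite cat_uniq !enum_uniq andbT /=; apply/hasPn => i.
  by rewrite !mem_enum inE.
have inj : injective (fun i : 'I_n => nth i l i).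
  move=> i j /=; rewrite (set_nth_default i) ?sl//.
  by move/eqP; rewrite nth_uniq ?sl// => /eqP/val_inj.
exists (perm inj) => i; rewrite permE nth_cat -cardE.
case: ltnP => iP; first by rewrite -mem_enum mem_nth// -cardE.
have : nth i (enum (~: P)%SET) (i - #|P|) \in enum (~: P)%SET.
  by rewrite mem_nth// -cardE ltn_subLR// cardsC card_ord.
by rewrite mem_enum inE => /negbTE.
Qed.

Section BlockForm.
Context {R : realType} {n m : nat}.

Lemma rank1_block_form (x : 'rV[R]_n) (y : 'rV[R]_m)
    (P := [set i | x 0 i != 0]%SET) (Q := [set j | y 0 j != 0]%SET)
    (epn : (#|P| + (n - #|P|) = n)%N) (eqm : (#|Q| + (m - #|Q|) = m)%N) :
  x != 0 -> y != 0 ->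
  exists (s : 'S_n) (t : 'S_m) (A : 'M[R]_(#|P|, #|Q|)),
    [/\ \rank A = 1%N, forall i j, A i j != 0 &
    row_perm s (col_perm t (x^T *m y)) = castmx (epn, eqm) (block_mx A 0 0 0)].
Proof.
move=> x0 y0.
have [s sP] := perm_gather P; have [t tQ] := perm_gather Q.
pose x' : 'rV[R]_#|P| := \row_i x 0 (s (cast_ord epn (lshift _ i))).
pose y' : 'rV[R]_#|Q| := \row_j y 0 (t (cast_ord eqm (lshift _ j))).
have x'0 i : x' 0 i != 0.
  by rewrite mxE; have := sP (cast_ord epn (lshift _ i)); rewrite inE /= ltn_ord.
have y'0 j : y' 0 j != 0.
  by rewrite mxE; have := tQ (cast_ord eqm (lshift _ j)); rewrite inE /= ltn_ord.
exists s, t, (x'^T *m y'); split.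
- have [i xi] := rV0Pn _ x0; have [j yj] := rV0Pn _ y0.
  have pP : (0 < #|P|)%N by apply/card_gt0P; exists i; rewrite inE.
  have pQ : (0 < #|Q|)%N by apply/card_gt0P; exists j; rewrite inE.
  apply: rank1_mul; apply/rV0Pn; first by exists (Ordinal pP).
  by exists (Ordinal pQ).
- by move=> i j; rewrite mul_col_row mulf_neq0.
apply/matrixP => i j; rewrite mxE mxE mul_col_row castmxE /=.
have si : (cast_ord epn (cast_ord (esym epn) i)) = i by apply: val_inj.
have tj : (cast_ord eqm (cast_ord (esym eqm) j)) = j by apply: val_inj.
rewrite -[in LHS]si -[in LHS]tj.
case: (split_ordP (cast_ord (esym epn) i)) => i' ->.
  case: (split_ordP (cast_ord (esym eqm) j)) => j' ->.
    by rewrite block_mxEul mul_col_row !mxE.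
  rewrite block_mxEur mxE; have := tQ (cast_ord eqm (rshift _ j')).
  by rewrite inE /= ltnNge leq_addr /= => /negbFE/eqP->; rewrite mulr0.
have xi0 : x 0 (s (cast_ord epn (rshift _ i'))) = 0.
  have := sP (cast_ord epn (rshift _ i')).
  by rewrite inE /= ltnNge leq_addr /= => /negbFE/eqP.
rewrite xi0 mul0r; case: (split_ordP (cast_ord (esym eqm) j)) => j' ->.
  by rewrite block_mxEdl mxE.
by rewrite block_mxEdr mxE.
Qed.

End BlockForm.

(** * A ball of matrices V whose minimizers have the prescribed support *)

Section PositiveMeasure.
Context {R : realType}.

Definition sign_row k (x : 'rV[R]_k) : 'rV[R]_k := \row_i Num.sg (x 0 i).

Lemma enorm_sign_row_ge1 k (x : 'rV[R]_k) : x != 0 -> 1 <= enorm (sign_row x).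
Proof.
move=> /rV0Pn[i xi]; apply: le_trans (abs_coord_le_enorm _ i).
by rewrite mxE normr_sg xi.
Qed.

(** Where [x] is nonzero, a_i u_i = c / |a| + a_i f_i. The first term exceeds 2 eps, since 2 eps |a|
    <= 2 eps r < 1/2 <= c, and the second is at least -2 eps. *)
Lemma sgr_near_sign_row k (x u f : 'rV[R]_k) (c r eps : R)
    (a := sign_row x) :
  u = c *: ((enorm a)^-1 *: a) + f -> 1 / 2 <= c -> enorm f <= 2 * eps ->
  enorm a <= r -> 16 * (eps * (r + 1)) <= 1 -> 0 <= eps ->
  forall i, x 0 i != 0 -> Num.sg (u 0 i) = Num.sg (x 0 i).
Proof.
move=> uE c2 fe ar er eps0 i xi.
have a1 : 1 <= enorm a by apply: enorm_sign_row_ge1; apply/rV0Pn; exists i.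
have ai : a 0 i = Num.sg (x 0 i) by rewrite mxE.
have aa : a 0 i * a 0 i = 1 by rewrite ai -expr2 sqr_sg xi.
have pos : 0 < a 0 i * u 0 i.
  have -> : a 0 i * u 0 i = a 0 i * a 0 i * (c / enorm a) + a 0 i * f 0 i.
    by rewrite uE !mxE; ring.
  rewrite aa mul1r.
  have fi : - (2 * eps) <= a 0 i * f 0 i.
    rewrite lerNl; apply: le_trans (ler_norm _) _.
    rewrite normrN normrM ai normr_sg xi mul1r.
    by rewrite (le_trans (abs_coord_le_enorm _ _)).
  have : 2 * eps < c / enorm a.
    have a0 : 0 < enorm a by exact: lt_le_trans a1.
    rewrite ltr_pdivlMr//.
    have : eps * enorm a <= eps * r by rewrite ler_wpM2l.
    lra.
  lra.
have u0 : u 0 i != 0 by apply: contraTneq pos => ->; rewrite mulr0 ltxx.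
have := gtr0_sg pos; rewrite sgrM ai sgr_id => h.
rewrite -[RHS]mulr1 -h mulrA -expr2 sqr_sg xi mul1r//.
Qed.

Lemma rank1_minimizers_positive_measure n m (x : 'rV[R]_n) (y : 'rV[R]_m) :
  x != 0 -> y != 0 ->
  exists S : set 'M[R]_(n, m), [/\ borel_mx S, (0 < lebesgue_mx S)%E &
    forall V, S V -> exists2 X0, minimizers rank_sparsity_ball V = [set X0] &
      \rank X0 = 1%N /\ supp X0 = supp (x^T *m y)].
Proof.
move=> x0 y0; pose a := sign_row x; pose b := sign_row y.
have a1 : 1 <= enorm a by exact: enorm_sign_row_ge1.
have b1 : 1 <= enorm b by exact: enorm_sign_row_ge1.
have aN0 : enorm a != 0 by rewrite gt_eqF// (lt_le_trans _ a1).
have bN0 : enorm b != 0 by rewrite gt_eqF// (lt_le_trans _ b1).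
pose r := enorm a * enorm b.
have ar : enorm a <= r by rewrite ler_peMr// enorm_ge0.
have br : enorm b <= r by rewrite ler_peMl// enorm_ge0.
have rN0 : r != 0 by rewrite mulf_neq0.
have r1 : 1 <= r by exact: le_trans ar.
pose ah := (enorm a)^-1 *: a; pose bh := (enorm b)^-1 *: b.
have ah1 : dot ah ah = 1 by rewrite dotZl dotZr -sqr_enorm expr2 mulKf ?mulVf.
have bh1 : dot bh bh = 1 by rewrite dotZl dotZr -sqr_enorm expr2 mulKf ?mulVf.
have ab i j : r * (ah^T *m bh) i j = a 0 i * b 0 j.
  by rewrite mul_col_row !mxE /r; field; rewrite aN0 bN0.
pose eps := (16 * (r + 1))^-1.
have eps_gt0 : 0 < eps by rewrite invr_gt0; lra.
have eps_r : 16 * (eps * (r + 1)) = 1.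
  by rewrite mulrCA mulVf// gt_eqF//; lra.
have eps16 : eps <= 1 / 16.
  have : eps * 1 <= eps * (r + 1) by rewrite ler_pM2l//; lra.
  lra.
have [i0 xi0] := rV0Pn _ x0; have [j0 yj0] := rV0Pn _ y0.
have nm0 : (0 < n * m)%N.
  by rewrite muln_gt0 (leq_ltn_trans _ (ltn_ord i0))// (leq_ltn_trans _ (ltn_ord j0)).
(* Entries of size at most [delta] give operator norm at most [eps] through [op_le_entrywise]. *)
pose delta := eps / (n * m)%:R.
have delta0 : 0 < delta by rewrite divr_gt0// ltr0n.
have deltaM : delta *+ (n * m) = eps.
  by rewrite -mulr_natr divfK// pnatr_eq0 -lt0n.
have delta_le : delta <= eps.
  by rewrite ler_pdivrMr ?ltr0n// ler_peMr ?ler1n// ltW.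
pose V0 : 'M[R]_(n, m) := - ((r + 1) *: (ah^T *m bh)).
have V0E i j : V0 i j = - ((r + 1) * (ah^T *m bh) i j).
  by rewrite /V0; move: (ah^T *m bh) => W; rewrite !mxE.
exists (ball V0 delta); split.
- by apply: sub_sigma_algebra; exact: ball_open.
(* The ball is open and entrywise, so it contains the closed cube with corner [V0] and half the
   radius as side. *)
- apply: (@lebesgue_mx_gt0 _ _ _ _ V0 (delta / 2)); first by rewrite divr_gt0.
  move=> X XV; split=> // i j; have := XV i j; rewrite /ball /= => h.
  by rewrite distrC ger0_norm; lra.
move=> V [_ VV0].
have VV i j : `|V0 i j - V i j| <= delta by apply/ltW; exact: (VV0 i j).
pose on i j := (x 0 i != 0) && (y 0 j != 0).
(* Only the perturbation on the support enters [E], so that [N], and with it [u] and [v], vanishes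
   where it should; the rest of [V] goes into [G]. *)
pose E : 'M[R]_(n, m) := \matrix_(i, j) if on i j then V0 i j - V i j else 0.
have Ele : op_le eps E.
  rewrite -deltaM; apply: op_le_entrywise => i j; rewrite mxE.
  by case: ifP => _ //; rewrite normr0 ltW.
have [|||lam [N [u [v [lam2 ME cN [uN vN] [u1 v1 strict [cu [fu [uE cu2 fu2]]]
  [cv [fv [vE cv2 fv2]]]]]]]]] := @perturbed_top_singular_pair R n m E ah bh r eps
    _ _ _ ah1 bh1 Ele; [lra|lra|by rewrite eps_r|].
have lam0 : 0 < lam by lra.
have offab i j : ~~ on i j -> a 0 i * b 0 j = 0.
  rewrite negb_and !negbK => /orP[] /eqP h; rewrite !mxE h sgr0 ?mulr0 ?mul0r//.
have MEij i j : (r + 1) * (ah^T *m bh) i j + E i j = lam * (a 0 i * b 0 j + N i j).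
  have ent c (A B : 'M[R]_(n, m)) : (c *: A + B) i j = c * A i j + B i j.
    by rewrite !mxE.
  by have /matrixP/(_ i j) := ME; rewrite ent [RHS]mxE ent ab.
have ahboff i j : ~~ on i j -> (ah^T *m bh) i j = 0.
  by move=> /offab h; apply: (mulfI rN0); rewrite ab h mulr0.
have Voff i j : ~~ on i j -> V0 i j = 0.
  by move=> offij; rewrite V0E ahboff// mulr0 oppr0.
have Noff i j : ~~ on i j -> N i j = 0.
  move=> offij; have := MEij i j; rewrite [E i j]mxE (negbTE offij) offab//.
  rewrite ahboff// mulr0 !add0r => /esym/eqP.
  by rewrite mulf_eq0 gt_eqF//= => /eqP.
have usg i : Num.sg (u 0 i) = Num.sg (x 0 i).
  have [xi|] := eqVneq (x 0 i) 0; last first.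
    by apply: (@sgr_near_sign_row _ x u fu cu r eps) => //; lra.
  rewrite xi -vN mxE big1// => j _; rewrite mxE Noff ?mulr0//.
  by rewrite negb_and xi eqxx.
have vsg j : Num.sg (v 0 j) = Num.sg (y 0 j).
  have [yj|] := eqVneq (y 0 j) 0; last first.
    by apply: (@sgr_near_sign_row _ y v fv cv r eps) => //; lra.
  rewrite yj -uN mxE big1// => i _; rewrite Noff ?mulr0//.
  by rewrite negb_and yj eqxx orbT.
have u_eq0 i : (u 0 i == 0) = (x 0 i == 0) by rewrite -sgr_eq0 usg sgr_eq0.
have v_eq0 j : (v 0 j == 0) = (y 0 j == 0) by rewrite -sgr_eq0 vsg sgr_eq0.
(* On the support [G] is the sign pattern; off it the l1 subgradient is free in [-1, 1] and absorbs
   -V / lam, since |V| <= delta < lam there. *)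
pose G : 'M[R]_(n, m) := \matrix_(i, j)
  if on i j then a 0 i * b 0 j else - (V i j / lam).
have := @minimizers_rank1 R n m V G N lam u v lam0.
set t := (_ + 1)^-1; have t0 : t != 0.
  by rewrite invr_neq0// gt_eqF// ltr_wpDl// l1norm_ge0.
move=> minE; exists (t *: (u^T *m v)).
  apply: minE => //.
  - apply/matrixP => i j; rewrite mxE [X in - X]mxE [(G + N) _ _]mxE [G _ _]mxE.
    case: ifPn => [onij|offij].
      by rewrite -MEij [E i j]mxE onij V0E; ring.
    by rewrite Noff// addr0 mulrN opprK mulrC divfK// gt_eqF.
  - move=> i j; rewrite mxE; case: ifPn => [_|offij].
      rewrite normrM !mxE !normr_sg -[leRHS]mulr1; apply: ler_pM => //.
        by case: (_ != _).
      by case: (_ != _).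
    rewrite normrN normrM normfV (gtr0_norm lam0) ler_pdivrMr// mul1r.
    by have := VV i j; rewrite Voff// sub0r normrN; lra.
  - move=> i j; rewrite mxE; case: ifPn => [_|offij].
      rewrite !mxE -usg -vsg mulrACA -!normrEsg -normrM//.
    have -> : u 0 i * v 0 j = 0.
      apply/eqP; rewrite mulf_eq0 u_eq0 v_eq0.
      by move: offij; rewrite negb_and !negbK.
    by rewrite mulr0 normr0.
split.
  rewrite scalemxAl -linearZ /=; apply: rank1_mul.
    rewrite scaler_eq0 negb_or t0 /=; apply/eqP => u0.
    by move: u1; rewrite u0 dot0l => /eqP; rewrite eq_sym oner_eq0.
  apply/eqP => v0.
  by move: v1; rewrite v0 dot0l => /eqP; rewrite eq_sym oner_eq0.
apply/predeqP => -[i j]; rewrite /supp /mkset /= mxE !mul_col_row.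
by rewrite !mulf_eq0 u_eq0 v_eq0 (negbTE t0).
Qed.

End PositiveMeasure.

Theorem theorem4p2 (R : realType) (n m : nat) (hnm : (n <= m)%N)
    (Xbar : 'M[R]_(n, m)) (hX : \rank Xbar = 1%N) :
  let K : set 'M[R]_(n, m) :=
    [set X | \rank X = 1%N /\ supp X = supp Xbar] in
  exists (p q : nat) (epn : (p + (n - p) = n)%N) (eqm : (q + (m - q) = m)%N),
    [/\ exists (s : 'S_n) (t : 'S_m) (A : 'M[R]_(p, q)),
          [/\ \rank A = 1%N,
              forall i j, A i j != 0 &
              row_perm s (col_perm t Xbar) =
                castmx (epn, eqm) (block_mx A 0 0 0)],
        analytic_manifold (p + q - 1) K &
        exists S : set 'M[R]_(n, m),
          [/\ borel_mx S,
              (0 < lebesgue_mx S)%E &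
              forall V, S V ->
                exists2 X0, minimizers rank_sparsity_ball V = [set X0] & K X0]].
Proof.
move=> K; have [x [y [XE x0 y0]]] := rank1_factor hX.
pose P := [set i | x 0 i != 0]%SET; pose Q := [set j | y 0 j != 0]%SET.
have pn : (#|P| + (n - #|P|) = n)%N.
  by rewrite subnKC// -[leqRHS]card_ord max_card.
have qm : (#|Q| + (m - #|Q|) = m)%N.
  by rewrite subnKC// -[leqRHS]card_ord max_card.
exists #|P|, #|Q|, pn, qm; split.
- by rewrite XE; exact: rank1_block_form.
- have [i xi] := rV0Pn _ x0; have [j yj] := rV0Pn _ y0.
  have Pi : i \in P by rewrite inE.
  have Qj : j \in Q by rewrite inE.
  have -> : K = [set X | \rank X = 1%N /\
      supp X = [set ij | ij.1 \in P /\ ij.2 \in Q]].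
    suff -> : [set ij | ij.1 \in P /\ ij.2 \in Q] = supp Xbar by [].
    rewrite XE; apply/predeqP => -[k l].
    rewrite /supp /mkset /= mul_col_row mulf_eq0 negb_or !inE.
    by split=> [[-> ->]|/andP].
  exact: rank1_manifold Pi Qj.
- by rewrite /K XE; exact: rank1_minimizers_positive_measure.
Qed.
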